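(* Let $\Pi$ be a Pasch space (either spherical or regular). Then for every point $A$ of $\Pi$ the boundary at infinity $\partial(\Pi,A)$, with its natural relation of betweenness and with the antipodal map sending each ray $r$ to its antipodal ray $a(r)$, is a spherical Pasch space.
   Context: A betweenness relation on a set $\Pi$ is a ternary relation ''$C$ is between $A$ and $B$'' such that, writing $s[A,B]$ for the set of all points between $A$ and $B$: (a) each point is between itself and any point of $\Pi$; (b) if $A$ is between $B$ and $C$, then $A$ is between $C$ and $B$; (c) if $C\in s[A,B]$, then $s[A,B]=s[A,C]\cup s[C,B]$ and $s[A,C]\cap s[C,B]=s[C,C]=\{C\}$. A closed line segment is a set of the form $s[A,B]$; its interior is $s(A,B)=s[A,B]\setminus\{A,B\}$. A subset $S$ is convex if $s[A,B]\subset S$ for all $A,B\in S$. A closed line segment is connected if, whenever it is expressed as a union of two disjoint non-empty convex subsets, precisely one of them is a closed line segment. A ray emanating from $A$ is a convex set $r$ such that: $A\in r$ but $A$ is not between any two other points of $r$; every three points of $r$ are contained in a closed line segment which is a subset of $r$; $r$ is not equal to any closed line segment. It is maximal if it is not a proper subset of another ray emanating from $A$, and connected if the closed line segments contained in it are connected. A space with maximal rays is a set with betweenness such that (1) if $s[A,B]$ and $s[A,C]$ have a common interior point, then one of them is contained in the other; (2) if $A\neq B$ and $s[A,B]$ is connected, then there is a connected $s[C,D]$ with $s[A,B]\subset s(C,D)$. Two maximal rays $r_1,r_2$ emanating from the same point $A$ are antipodal if there are $B\in r_1$, $C\in r_2$ with $A\in s(B,C)$; each connected maximal ray $r$ has exactly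 one antipodal maximal ray, denoted $a(r)$. The boundary at infinity $\partial(\Pi,A)$ is the set of connected maximal rays emanating from $A$. A Pasch space is a space $\Pi$ with maximal rays satisfying the Pasch Condition: for every $A\in\Pi$ and every subset $\{r_1,r_2,r_3\}$ of $\partial(\Pi,A)$ disjoint from the set of its antipodal rays, and all points $B,C\in r_1\setminus\{A\}$ and $D\in r_3\setminus\{A\}$, if $r_2$ intersects $s[B,D]$ then $r_2$ intersects $s[C,D]$. A regular Pasch space is a Pasch space in which all closed line segments are connected. A spherical Pasch space is a Pasch space equipped with a map $a:\Pi\to\Pi$ (the antipodal map) with $a^2=\mathrm{id}$, $a(B)\neq B$ for all $B$, and $a(s[B,C])=s[a(B),a(C)]$ for all $B,C$, such that: for non-antipodal points $A,B$ (i.e. $B\ne a(A)$) $s[A,B]$ is connected; $s[A,B]$ consists of exactly two points if $a(B)=A$; and if $r_1,r_2$ are maximal rays emanating from the same point and $r_1\cup r_2$ contains a pair of antipodal points, then $r_1$ and $r_2$ are antipodal rays. The natural betweenness on $\partial(\Pi,A)$: if $r_1,r_2$ are antipodal or equal, $s[r_1,r_2]=\{r_1,r_2\}$; otherwise $r_3\in s[r_1,r_2]$ iff for every $B\in r_1$ and $C\in r_2$ the ray $r_3$ intersects $s[B,C]$. *)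

(* Defs.v *)
From mathcomp Require Import all_boot all_classical.
Set Implicit Arguments.
Unset Strict Implicit.
Unset Printing Implicit Defensive.

Local Open Scope classical_set_scope.

(* A ternary relation "C is between A and B" on T is given by its segments
   s : T -> T -> set T, where s A B C reads "C is between A and B", so that
   s A B is the closed line segment s[A,B]. *)

Record is_betweenness (T : Type) (s : T -> T -> set T) : Prop := {
  between_self : forall A B, s A B A ;
  between_sym : forall A B C, s B C A -> s C B A ;
  between_split : forall A B C, s A B C -> s A B = s A C `|` s C B ;
  between_meet : forall A B C, s A B C ->
    s A C `&` s C B = s C C /\ s C C = [set C] }.

Section Segments.
Context (T : Type) (s : T -> T -> set T).
Implicit Types (A B C D : T) (S r : set T).

Definition is_segment S : Prop := exists A B, S = s A B.

Definition seg_interior A B : set T := s A B `\` [set A; B].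

Definition convex_set S : Prop := forall A B, S A -> S B -> s A B `<=` S.

Definition connected_segment S : Prop :=
  forall C1 C2 : set T,
    convex_set C1 -> convex_set C2 -> C1 !=set0 -> C2 !=set0 ->
    C1 `&` C2 = set0 -> S = C1 `|` C2 ->
    (is_segment C1 /\ ~ is_segment C2) \/ (~ is_segment C1 /\ is_segment C2).

Record is_ray A r : Prop := {
  ray_convex : convex_set r ;
  ray_origin : r A ;
  ray_extremal : forall B C, r B -> r C -> B <> A -> C <> A -> ~ s B C A ;
  ray_triple : forall B C D, r B -> r C -> r D ->
    exists E F, [/\ s E F B, s E F C, s E F D & s E F `<=` r] ;
  ray_not_segment : ~ is_segment r }.

Definition maximal_ray A r : Prop :=
  is_ray A r /\ forall r', is_ray A r' -> ~ (r `<` r').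

Definition connected_ray r : Prop :=
  forall B C, s B C `<=` r -> connected_segment (s B C).

(* To be used for maximal rays r1 and r2 emanating from A. *)
Definition antipodal_rays A r1 r2 : Prop :=
  exists B C, [/\ r1 B, r2 C & seg_interior B C A].

Record is_space_with_maximal_rays : Prop := {
  swmr_betweenness : is_betweenness s ;
  swmr_nested : forall A B C,
    seg_interior A B `&` seg_interior A C !=set0 ->
    s A B `<=` s A C \/ s A C `<=` s A B ;
  swmr_extend : forall A B, A <> B -> connected_segment (s A B) ->
    exists C D, connected_segment (s C D) /\ s A B `<=` seg_interior C D }.

Definition boundary A : set (set T) :=
  [set r | maximal_ray A r /\ connected_ray r].

Definition pasch_condition : Prop :=
  forall A (r1 r2 r3 : set T),
    [set r1; r2; r3] `<=` boundary A ->
    (forall r r', [set r1; r2; r3] r -> [set r1; r2; r3] r' ->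
       ~ antipodal_rays A r r') ->
    forall B C D, (r1 `\ A) B -> (r1 `\ A) C -> (r3 `\ A) D ->
      r2 `&` s B D !=set0 -> r2 `&` s C D !=set0.

Record is_pasch : Prop := {
  pasch_space : is_space_with_maximal_rays ;
  pasch_cond : pasch_condition }.

Record is_regular_pasch : Prop := {
  regular_pasch : is_pasch ;
  regular_connected : forall A B, connected_segment (s A B) }.

Record is_spherical_pasch (a : T -> T) : Prop := {
  spherical_pasch : is_pasch ;
  spherical_invol : forall B, a (a B) = B ;
  spherical_nofix : forall B, a B <> B ;
  spherical_seg : forall B C, a @` s B C = s (a B) (a C) ;
  spherical_connected : forall A B, B <> a A -> connected_segment (s A B) ;
  spherical_pair : forall A B, a B = A ->
    exists X Y, X <> Y /\ s A B = [set X; Y] ;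
  spherical_rays : forall A r1 r2, maximal_ray A r1 -> maximal_ray A r2 ->
    (exists B, (r1 `|` r2) B /\ (r1 `|` r2) (a B)) ->
    antipodal_rays A r1 r2 }.

Definition boundary_between A (r1 r2 : boundary A) : set (boundary A) :=
  if `[< antipodal_rays A (val r1) (val r2) \/ r1 = r2 >]
  then [set r1; r2]
  else [set r3 : boundary A | forall B C, val r1 B -> val r2 C ->
          val r3 `&` s B C !=set0].

(* a r is the unique maximal ray emanating from A that is antipodal to r. *)
Definition is_antipodal_ray_map A (a : boundary A -> boundary A) : Prop :=
  forall (r : boundary A) (r' : set T), maximal_ray A r' ->
    (antipodal_rays A (val r) r' <-> r' = val (a r)).

End Segments.

(* Main.v *)
(* Fix A and identify a direction at A with a maximal ray emanating from A.
   Two directions u, v in general position (neither equal nor antipodal) span a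
   triangle A, B, C with B on u and C on v, and by the Pasch condition the
   central projection from A identifies s[B,C] with s[u,v]; connectedness, the
   betweenness axioms, the nesting of segments and the Pasch condition of the
   boundary are then read off in Pi, the latter two by applying the Pasch
   condition with apex B.  If w is between u and v, then v is between w and the
   ray opposite to u; three such turns show that the antipodal map preserves
   betweenness, and one turn shows that rays through v and a(v) are antipodal.

   The regular and the spherical case only differ in one fact: the line
   through A and P, i.e. the ray from A through P, its opposite and the antipode
   of A if there is one, contains with any two points the whole ray from one
   through the other.  On the sphere this follows from the axiom on rays through
   antipodal points.  In a regular space it means that a line does not close up:
   if A is between points of two opposite rays, it is between any two points
   of them, which rests on the Pasch condition. *)
Require Import Defs.
From mathcomp Require Import all_boot all_classical.

Set Implicit Arguments.
Unset Strict Implicit.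
Unset Printing Implicit Defensive.

Local Open Scope classical_set_scope.

(* Common ground of the regular and the spherical case: [s A B] is connected
   as soon as it has an interior point. *)
Record is_line_space (T : Type) (s : T -> T -> set T) : Prop := {
  line_space : is_space_with_maximal_rays s ;
  line_connected : forall A B,
    seg_interior s A B !=set0 -> connected_segment s (s A B) }.

Section Directions.
Context {T : Type} (s : T -> T -> set T).
Implicit Types (A P Q X : T).

Definition joined A P : Prop := A <> P /\ connected_segment s (s A P).

(* For [joined A P], the maximal ray emanating from [A] through [P]. *)
Definition dir A P : set T := [set X | s A P X \/ s A X P].

(* Meant for [P] and [Q] distinct from [A]: [dir A A] is the whole space. *)
Definition opposite A P Q : Prop := exists P' Q',
  [/\ dir A P P', dir A Q Q', P' <> A, Q' <> A & s P' Q' A].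

(* The full line (great circle) through [A] and [P]; the last clause adds
   the antipode of [A] in the spherical case. *)
Definition line A P : set T := [set X |
  [\/ X = A, dir A P X, opposite A P X | ~ connected_segment s (s A X)]].

End Directions.

(** * Betweenness and rays *)

Section LineSpace.
Context (T : Type) (s : T -> T -> set T) (hl : is_line_space s).
Implicit Types (A B C D E F P Q X Y Z W : T).
Local Notation joined := (joined s).
Local Notation dir := (dir s).
Local Notation opposite := (opposite s).
Local Notation line := (line s).

Let hb : is_betweenness s.
Proof. exact: swmr_betweenness (line_space hl). Qed.

Lemma btL A B : s A B A.
Proof. exact: between_self. Qed.

Lemma btC A B C : s A B C -> s B A C. Proof. exact: between_sym. Qed.

Lemma btR A B : s A B B. Proof. exact/btC/btL. Qed.

Lemma bt_id A B : s A A B -> B = A.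
Proof. by have [_ ->] := between_meet hb (btL A A). Qed.

Lemma bt_split A B C D : s A B C -> s A B D -> s A C D \/ s C B D.
Proof. by move=> /(between_split hb) ->. Qed.

Lemma bt_subl A B C D : s A B C -> s A C D -> s A B D.
Proof. by move=> /(between_split hb) -> ?; left. Qed.

Lemma bt_subr A B C D : s A B C -> s C B D -> s A B D.
Proof. by move=> /(between_split hb) -> ?; right. Qed.

Lemma bt_meet A B C D : s A B C -> s A C D -> s C B D -> D = C.
Proof.
move=> h h1 h2; have [e1 e2] := between_meet hb h.
by have : (s A C `&` s C B) D by []; rewrite e1 e2.
Qed.

Lemma bt_anti A B C : s A B C -> s A C B -> B = C.
Proof. by move=> h h1; apply: bt_meet h h1 (btR _ _). Qed.

Lemma bt_inl A B C D : s A B C -> s A C D -> s D B C.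
Proof.
move=> h h1; have [h2|//] := bt_split (bt_subl h h1) h.
by rewrite (bt_anti h1 h2); exact: btL.
Qed.

Lemma bt_inr A B C D : s A B C -> s C B D -> s A D C.
Proof. by move=> /btC h /btC h1; apply/btC/(bt_inl h h1). Qed.

Lemma bt_total A B C D : s A B C -> s A B D -> s A C D \/ s A D C.
Proof. by move=> h h1; have [|/(bt_inr h)] := bt_split h h1; [left|right]. Qed.

Lemma bt_sub A B C D E : s A B C -> s A B D -> s C D E -> s A B E.
Proof.
move=> hC hD h; have [h1|h1] := bt_split hC hD.
  by apply: (bt_subl hC); apply: bt_subr h1 (btC h).
by apply: (bt_subr hC); apply: bt_subl h1 h.
Qed.

Lemma segment_convex A B : convex_set s (s A B).
Proof. by move=> C D hC hD E; apply: bt_sub. Qed.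

(** One of [C] and [D] lies between [A] and the other; antisymmetry identifies it with [A]. *)
Lemma bt_extremal A B C D : s A B C -> s A B D -> s C D A -> A = C \/ A = D.
Proof.
move=> hC hD h; have [h1|h1] := bt_total hC hD.
  by right; apply/esym/(bt_anti h (btC h1)).
by left; apply/esym/(bt_anti (btC h) (btC h1)).
Qed.

(** * Connected segments *)

Lemma connected_point A : connected_segment s (s A A).
Proof.
move=> C1 C2 _ _ [x x1] [y y2] C12 e.
have xA : x = A by apply: bt_id; rewrite e; left.
have yA : y = A by apply: bt_id; rewrite e; right.
have : (C1 `&` C2) A by split; [rewrite -xA|rewrite -yA].
by rewrite C12.
Qed.

(** Without a point strictly between [X] and [Y], the segment would be the disjoint union of [s A X]
    and [s Y B], two closed segments. *)
Lemma connected_dense A B X Y : connected_segment s (s A B) ->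
  s A B X -> s X B Y -> X <> Y -> exists2 Z, s X Y Z & Z <> X /\ Z <> Y.
Proof.
move=> co hX hY XY; apply: contrapT => hn.
have hXY := bt_inr hX hY; have hAY := bt_subr hX hY.
suff [] : (is_segment s (s A X) /\ ~ is_segment s (s Y B)) \/
          (~ is_segment s (s A X) /\ is_segment s (s Y B)).
- by move=> [_ []]; exists Y, B.
- by move=> [[]]; exists A, X.
apply: co; [exact: segment_convex|exact: segment_convex| | | |].
- by exists A; exact: btL.
- by exists B; exact: btR.
- rewrite -subset0 => Z [h1 h2]; apply: XY.
  have e : Z = Y by apply: bt_meet hAY (bt_subl hXY h1) h2.
  by rewrite e in h1; apply: bt_anti h1 hXY.
- rewrite eqEsubset; split=> Z.
    move=> hZ; have [?|h] := bt_split hX hZ; first by left.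
    have [h2|?] := bt_split hY h; last by right.
    have [->|ZX] := EM (Z = X); first by left; exact: btR.
    have [->|ZY] := EM (Z = Y); first by right; exact: btL.
    by case: hn; exists Z.
  by case=> h; [apply: bt_subl h|apply: bt_subr h].
Qed.

Lemma connected_nontriv A B : connected_segment s (s A B) -> A <> B ->
  exists2 Z, s A B Z & Z <> A /\ Z <> B.
Proof. by move=> h; apply: connected_dense h _ _; [exact: btL|exact: btR]. Qed.

(** A Dedekind cut: [L] and its complement split [s A B] into two convex pieces, one of which is a
    closed segment. Extremality of [A] or [B] makes it one end of that piece; the other end is
    [M]. *)
Lemma connected_cut A B (L : set T) : connected_segment s (s A B) ->
  L A -> ~ L B -> (forall X Y, s A B X -> L X -> s A X Y -> L Y) ->
  (exists2 M, s A B M /\ L M & forall X, s A B X -> L X -> s A M X) \/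
  (exists2 M, s A B M /\ ~ L M & forall X, s A B X -> ~ L X -> s M B X).
Proof.
move=> co LA LB down.
have : (is_segment s (s A B `&` L) /\ ~ is_segment s (s A B `\` L)) \/
       (~ is_segment s (s A B `&` L) /\ is_segment s (s A B `\` L)).
  apply: co; [| | | |by rewrite setDE setIACA setICr setI0|].
  - move=> C D [hC LC] [hD LD] E hE; split; first exact: bt_sub hC hD hE.
    have [h|h] := bt_total hC hD.
      by apply: (down _ _ hC LC); apply: bt_subr h (btC hE).
    by apply: (down _ _ hD LD); apply: bt_subr h hE.
  - move=> C D [hC LC] [hD LD] E hE; split; first exact: bt_sub hC hD hE.
    move=> LE; have [h|h] := bt_total hC hD.
      by apply: LD; apply: (down _ _ (bt_sub hC hD hE) LE);
        apply: bt_inr h (btC hE).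
    by apply: LC; apply: (down _ _ (bt_sub hC hD hE) LE); apply: bt_inr h hE.
  - by exists A; split=> //; exact: btL.
  - by exists B; split=> //; exact: btR.
  - by rewrite setUIDK.
case=> [[[E [F e]] _]|[_ [E [F e]]]]; [left|right].
  have [hE LE] : (s A B `&` L) E by rewrite e; exact: btL.
  have [hF LF] : (s A B `&` L) F by rewrite e; exact: btR.
  have hA : s E F A by rewrite -e; split=> //; exact: btL.
  have [AE|AF] := bt_extremal hE hF hA.
    exists F => // X hX LX; rewrite AE.
    by have : (s A B `&` L) X by []; rewrite e.
  exists E => // X hX LX; rewrite AF; apply: btC.
  by have : (s A B `&` L) X by []; rewrite e.
have [hE LE] : (s A B `\` L) E by rewrite e; exact: btL.
have [hF LF] : (s A B `\` L) F by rewrite e; exact: btR.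
have hB : s E F B by rewrite -e; split=> //; exact: btR.
have [BE|BF] := bt_extremal (btC hE) (btC hF) hB.
  exists F => // X hX LX; rewrite BE; apply: btC.
  by have : (s A B `\` L) X by []; rewrite e.
exists E => // X hX LX; rewrite BF.
by have : (s A B `\` L) X by []; rewrite e.
Qed.

(** * Joined points and prolongation *)

Lemma joined_interior A B C : s A B C -> C <> A -> C <> B -> joined A B.
Proof.
move=> h CA CB; split; last by apply: (line_connected hl); exists C;
  split=> // -[].
by move=> e; rewrite -e in h; apply: CA; apply: bt_id h.
Qed.

Lemma joinedC A B : joined A B -> joined B A.
Proof.
move=> [AB co]; have [Z h [ZA ZB]] := connected_nontriv co AB.
by apply: joined_interior (btC h) _ _.
Qed.

Lemma joined_sub A B X Y : joined A B -> s A B X -> s A B Y -> X <> Y ->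
  joined X Y.
Proof.
move=> [AB co] hX hY XY; have [h|h] := bt_split hX hY.
  have [Z hZ [ZX ZY]] := connected_dense co hY (bt_inl hX h) (nesym XY).
  exact: joined_interior (btC hZ) _ _.
have [Z hZ [ZX ZY]] := connected_dense co hX h XY.
exact: joined_interior hZ _ _.
Qed.

Lemma joined_subl A B X : joined A B -> s A B X -> X <> A -> joined A X.
Proof.
by move=> h hX XA; apply: (joined_sub h (btL _ _) hX) => e; apply: XA.
Qed.

Lemma joined_dense A P : joined A P -> exists2 Q, s A P Q & Q <> A /\ Q <> P.
Proof. by move=> [AP co]; apply: connected_nontriv co AP. Qed.

Lemma joined_supl A P X : joined A P -> s A X P -> joined A X.
Proof.
move=> hP h; have [Q hQ [QA QP]] := joined_dense hP.
apply: (@joined_interior _ _ Q) => //; first exact: bt_subl h hQ.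
by move=> e; apply: QP; apply/esym/(bt_anti hQ); rewrite e.
Qed.

Lemma extend A B : joined A B -> exists2 C, s A C B & C <> B /\ joined A C.
Proof.
move=> [AB co]; have [C [D [coCD sub]]] := swmr_extend (line_space hl) AB co.
have [hA nA] := sub _ (btL A B); have [hB nB] := sub _ (btR A B).
have CD : C <> D by move=> e; apply: nA; left; apply: bt_id; rewrite {2}e.
have [h|h] := bt_split hA hB.
  exists C; first exact: btC.
  split; first by move=> e; apply: nB; left.
  apply: joined_sub (conj CD coCD) hA (btL _ _) _.
  by move=> e; apply: nA; left.
exists D => //; split; first by move=> e; apply: nB; right.
apply: joined_sub (conj CD coCD) hA (btR _ _) _.
by move=> e; apply: nA; right.
Qed.

Lemma extend_back A B : joined A B ->
  exists C, [/\ s C B A, C <> A & joined A C].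
Proof.
move=> h; have [C hC [CA hj]] := extend (joinedC h).
exists C; split=> //; first exact: btC.
by apply: joined_sub hj hC (btR _ _) _ => e; apply: CA.
Qed.

(** As [P] may coincide with [X] or [Y], the common interior point for the nesting axiom is chosen
    strictly between [A] and [P]. *)
Lemma nested A P X Y : joined A P -> s A X P -> s A Y P -> s A X Y \/ s A Y X.
Proof.
move=> hP hX hY; have [Q hQ [QA QP]] := joined_dense hP.
have [|h|h] := swmr_nested (line_space hl) (A := A) (B := X) (C := Y).
- exists Q; split; split.
  + exact: bt_subl hX hQ.
  + by move=> [//|e]; apply: QP; apply/esym/(bt_anti hQ); rewrite e.
  + exact: bt_subl hY hQ.
  + by move=> [//|e]; apply: QP; apply/esym/(bt_anti hQ); rewrite e.
- by right; apply: h; exact: btR.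
by left; apply: h; exact: btR.
Qed.

(** * Directions and opposite directions *)

Lemma dirC A P X : dir A P X -> dir A X P.
Proof. by move=> [h|h]; [right|left]. Qed.

Lemma dir_refl A P : dir A P P.
Proof. by left; exact: btR. Qed.

Lemma dir_origin A P : dir A P A.
Proof. by left; exact: btL. Qed.

Lemma joined_dir A P X : joined A P -> dir A P X -> X <> A -> joined A X.
Proof. by move=> h [hX|hX] XA;
  [apply: joined_subl hX XA|apply: joined_supl hX]. Qed.

Lemma dir_trans A P X Y : joined A P -> dir A P X -> dir A P Y -> dir A X Y.
Proof.
move=> h [hX|hX] [hY|hY].
- by have [?|?] := bt_total hX hY; [left|right].
- by right; apply: bt_subl hY hX.
- by left; apply: bt_subl hX hY.
- by have [?|?] := nested h hX hY; [left|right].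
Qed.

Lemma dir_eq A P X : joined A P -> X <> A -> dir A P X -> dir A P = dir A X.
Proof.
move=> h XA hX; rewrite eqEsubset; split=> Y; first exact: dir_trans h hX.
by apply: dir_trans (dirC hX); apply: joined_dir h hX XA.
Qed.

Lemma oppositeC A P Q : opposite A P Q -> opposite A Q P.
Proof. by move=> [P' [Q' [h1 h2 h3 h4 h5]]]; exists Q', P'; split=> //;
  exact: btC. Qed.

Lemma opposite_dirl A P Q X : joined A P -> dir A P X -> X <> A ->
  opposite A P Q -> opposite A X Q.
Proof.
by move=> h hX XA [P' [Q' [h1 h2 h3 h4 h5]]]; exists P', Q'; split=> //;
  apply: dir_trans h hX h1.
Qed.

Lemma opposite_dirr A P Q X : joined A Q -> dir A Q X -> X <> A ->
  opposite A P Q -> opposite A P X.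
Proof. by move=> h hX XA /oppositeC/(opposite_dirl h hX XA)/oppositeC. Qed.

Lemma opposite_irrefl A P Q : joined A P -> Q <> A -> dir A P Q ->
  ~ opposite A P Q.
Proof.
move=> h QA hd [P' [Q' [hP' hQ' P'A Q'A hA]]].
have hPQ : dir A P Q' by rewrite (dir_eq h QA hd).
have [h1|h1] := dir_trans h hP' hPQ.
  by apply: Q'A; apply: bt_anti hA (btC h1).
by apply: P'A; apply: bt_anti (btC hA) (btC h1).
Qed.

Lemma opposite_between A P Q : s P Q A -> P <> A -> Q <> A -> opposite A P Q.
Proof. by move=> h PA QA; exists P, Q; split=> //; exact: dir_refl. Qed.

Lemma dir_min A P Q : dir A P Q -> P <> A -> Q <> A ->
  exists X, [/\ s A P X, s A Q X & X <> A].
Proof.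
move=> [h|h] PA QA; first by exists Q; split=> //; exact: btR.
by exists P; split=> //; exact: btR.
Qed.

(** The witnesses can be moved towards [A] into the given segments, and [A] stays between them. *)
Lemma opposite_close A P Q : P <> A -> Q <> A -> opposite A P Q ->
  exists P' Q', [/\ s A P P', s A Q Q', P' <> A, Q' <> A & s P' Q' A].
Proof.
move=> PA QA [P' [Q' [hP' hQ' P'A Q'A hA]]].
have [P1 [hP1 hP1' P1A]] := dir_min hP' PA P'A.
have [Q1 [hQ1 hQ1' Q1A]] := dir_min hQ' QA Q'A.
exists P1, Q1; split=> //.
exact: bt_inr (btC (bt_inr (btC hA) hP1')) hQ1'.
Qed.

(** The nearer of the two witnesses on the side of [P] serves for both. Seen from it, points towards
    [Q] and [R] lie beyond [A], so nesting makes them comparable. *)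
Lemma opposite_uniq A P Q R : joined A P -> joined A Q -> joined A R ->
  opposite A P Q -> opposite A P R -> dir A Q R.
Proof.
move=> hP hQ hR [P1 [Q1 [d1 e1 P1A Q1A h1]]] [P2 [R2 [d2 e2 P2A R2A h2]]].
suff h : dir A Q1 R2.
  rewrite -(dir_eq hQ Q1A e1) in h.
  exact: dir_trans (joined_dir hR e2 R2A) (dirC h) (dirC e2).
have aux P' P'' Q' R' : P' <> A -> Q' <> A -> R' <> A -> s A P'' P' ->
  s P' Q' A ->
    s P'' R' A -> dir A Q' R'.
  move=> P'A Q'A R'A hp hq hr.
  have hr' : s P' R' A by exact: btC (bt_inr (btC hr) hp).
  have hj : joined P' A.
    apply: joined_subl (joined_interior hq _ _) hq _; exact: nesym.
  have [h|h] := nested hj hq hr'.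
    by left; apply: bt_inl h hr'.
  by right; apply: bt_inl h hq.
have [h|h] := dir_trans hP d1 d2.
  by apply/dirC/(aux _ _ _ _ P2A R2A Q1A h h2 h1).
by apply: (aux _ _ _ _ P1A Q1A R2A h h1 h2).
Qed.

Lemma opposite_exists A P : joined A P -> exists Q,
  [/\ joined A Q, s P Q A & opposite A P Q].
Proof.
move=> h; have [Q [hA QA hQ]] := extend_back h.
exists Q; split=> //; first exact: btC.
apply: opposite_between (btC hA) _ QA.
by move=> e; case: h => + _; rewrite e.
Qed.

(** * Maximal rays *)

Lemma dir_ray A P : joined A P -> is_ray s A (dir A P).
Proof.
move=> h.
(* Three properties yield the ray axioms: any two points lie in some [s A F] ([top]), initial
   segments stay in the set ([down]), and no point is last ([beyond]). *)
have top X Y : dir A P X -> dir A P Y ->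
    exists F, [/\ dir A P F, s A F X & s A F Y].
  move=> hX hY; have [hXY|hXY] := dir_trans h hX hY.
    by exists X; split=> //; exact: btR.
  by exists Y; split=> //; exact: btR.
have down X F : dir A P F -> s A F X -> dir A P X.
  move=> [hF|hF] hX; first by left; apply: bt_subl hF hX.
  by have [?|?] := bt_total hF hX; [left|right].
have beyond F : dir A P F -> exists F', [/\ dir A P F', s A F' F & F' <> F].
  move=> [hF|hF].
    have [FP|FP] := EM (F = P).
      have [F' hF' [F'P _]] := extend h.
      by exists F'; rewrite FP; split=> //; right.
    by exists P; split=> //; [exact: dir_refl|exact: nesym].
  have [F' hF' [F'P _]] := extend (joined_supl h hF).
  by exists F'; split=> //; right; apply: bt_subl hF' hF.
split.
- move=> X Y hX hY Z hZ; have [F [hF h1 h2]] := top _ _ hX hY.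
  exact: down hF (bt_sub h1 h2 hZ).
- exact: dir_origin.
- move=> X Y hX hY XA YA hA; have [F [hF h1 h2]] := top _ _ hX hY.
  by have [e|e] := bt_extremal h1 h2 hA; [apply: XA|apply: YA].
- move=> X Y Z hX hY hZ; have [F [hF hFX hFY]] := top _ _ hX hY.
  have [G [hG hGF hGZ]] := top _ _ hF hZ.
  exists A, G; split=> //; [exact: bt_subl hGF _|exact: bt_subl hGF _|].
  by move=> W; apply: down.
- move=> [E [F e]].
  have hEF : s E F A by rewrite -e; exact: dir_origin.
  have hE : dir A P E by rewrite e; exact: btL.
  have hF : dir A P F by rewrite e; exact: btR.
  have [G [hG hGE hGF]] := top _ _ hE hF.
  have [M [hM hMG MG]] := beyond _ hG.
  have hMEF : s E F M by rewrite -e.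
  by apply: MG; apply: bt_anti hMG (bt_sub hGE hGF hMEF).
Qed.

(** In a segment of [r] through [A], [X] and [Y], extremality forces [A] to be an end. *)
Lemma ray_top A r X Y : is_ray s A r -> r X -> r Y ->
  exists F, [/\ r F, s A F X & s A F Y].
Proof.
move=> hr rX rY; have [E [F [hA hX hY sub]]] :=
  ray_triple hr (ray_origin hr) rX rY.
have rE : r E by apply: sub; exact: btL.
have rF : r F by apply: sub; exact: btR.
have [EA|EA] := EM (E = A); first by exists F; rewrite -EA.
have [FA|FA] := EM (F = A); last by case: (ray_extremal hr rE rF EA FA).
by exists E; rewrite -FA; split=> //; exact: btC.
Qed.

Lemma ray_beyond A r X : is_ray s A r -> r X ->
  exists F, [/\ r F, s A F X & F <> X].
Proof.
move=> hr rX; apply: contrapT => hn; apply: (ray_not_segment hr).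
exists A, X; rewrite eqEsubset; split=> Y; last first.
  exact: (ray_convex hr (ray_origin hr) rX).
move=> rY; have [F [rF hX hY]] := ray_top hr rX rY.
have [FX|FX] := EM (F = X); first by rewrite -FX.
by case: hn; exists F.
Qed.

Lemma ray_joined A r P : is_ray s A r -> r P -> P <> A -> joined A P.
Proof.
move=> hr rP PA; have [F [rF hF FP]] := ray_beyond hr rP.
by apply: joined_subl (joined_interior hF PA (nesym FP)) hF PA.
Qed.

Lemma ray_sub_dir A r P : is_ray s A r -> r P -> r `<=` dir A P.
Proof.
move=> hr rP X rX; have [F [rF hP hX]] := ray_top hr rP rX.
by have [?|?] := bt_total hP hX; [left|right].
Qed.

Lemma ray_other A r : is_ray s A r -> exists2 P, r P & P <> A.
Proof.
move=> hr; have [F [rF _ FA]] := ray_beyond hr (ray_origin hr).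
by exists F.
Qed.

Lemma dir_maximal A P : joined A P -> maximal_ray s A (dir A P).
Proof.
move=> h; split; first exact: dir_ray.
move=> r' hr' [sub]; apply.
exact: ray_sub_dir hr' (sub _ (dir_refl A P)).
Qed.

(** Every ray through [P] lies in [dir A P], which is itself a ray. *)
Lemma maximal_rayE A r P : maximal_ray s A r -> r P -> P <> A -> r = dir A P.
Proof.
move=> [hr max] rP PA; have hP := ray_joined hr rP PA.
apply: contrapT => ne; apply: (max _ (dir_ray hP)).
split; first exact: ray_sub_dir.
by move=> h; apply: ne; rewrite eqEsubset; split=> //; exact: ray_sub_dir.
Qed.

(** Consequently the boundary at [A] consists of all maximal rays emanating from [A]. *)
Lemma maximal_ray_connected A r : maximal_ray s A r -> connected_ray s r.
Proof.
move=> [hr _] B C sub; have [BC|BC] := EM (B = C).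
  by rewrite BC; exact: connected_point.
have rB : r B by apply: sub; exact: btL.
have rC : r C by apply: sub; exact: btR.
have [F [rF hB hC]] := ray_top hr rB rC.
have FA : F <> A.
  by move=> FA; rewrite FA in hB hC; apply: BC; rewrite (bt_id hB) (bt_id hC).
by have [] := joined_sub (ray_joined hr rF FA) hB hC BC.
Qed.

Lemma antipodal_dir A P Q :
  antipodal_rays s A (dir A P) (dir A Q) <-> opposite A P Q.
Proof.
split=> [[B [C [hB hC [hA nA]]]]|[B [C [hB hC BA CA hA]]]]; exists B, C.
  by split=> // e; apply: nA; rewrite e; [left|right].
by split=> //; split=> // -[] e; [apply: BA|apply: CA].
Qed.

(** * Lines *)

Lemma line_origin A P : line A P A. Proof. by constructor 1. Qed.

Lemma line_direction A P : line A P P.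
Proof. by constructor 2; exact: dir_refl. Qed.

Lemma lineE A P X : joined A X -> line A P X -> dir A P X \/ opposite A P X.
Proof.
by move=> [AX co] [e|h|h|h]; [case: AX; rewrite e|left|right|case: h].
Qed.

Lemma line_sub A P X : joined A P -> joined A X -> line A P X ->
  line A P `<=` line A X.
Proof.
move=> hP hX hl' Y hY; have [->|YA] := EM (Y = A); first exact: line_origin.
have [co|nco] := EM (connected_segment s (s A Y)); last by constructor 4.
have hAY : joined A Y by split=> // e; apply: YA.
have XA : X <> A by move=> e; case: hX => + _; rewrite e.
have [h|h] := lineE hX hl'; have [h'|h'] := lineE hAY hY.
- by constructor 2; apply: dir_trans hP h h'.
- by constructor 3; apply: opposite_dirl hP h XA h'.
- by constructor 3; apply: opposite_dirr hP h' YA (oppositeC h).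
- by constructor 2; apply: opposite_uniq hP hX hAY h h'.
Qed.

Lemma lineC A P X : joined A P -> joined A X -> line A P X -> line A X P.
Proof.
by move=> hP hX h; apply: (line_sub hP hX h); exact: line_direction.
Qed.

Lemma line_eq A P X : joined A P -> joined A X -> line A P X ->
  line A P = line A X.
Proof.
move=> hP hX h; rewrite eqEsubset; split; first exact: line_sub.
by apply: line_sub => //; apply: lineC.
Qed.

Lemma line_back A X : joined A X -> dir X A `<=` line A X.
Proof.
move=> hX Z [h|h]; first by constructor 2; left; apply: btC.
have [->|ZA] := EM (Z = A); first exact: line_origin.
constructor 3; apply: opposite_between h _ ZA.
by move=> e; case: hX => + _; rewrite e.
Qed.

Lemma dir_boundary A P : joined A P -> boundary s A (dir A P).
Proof.
move=> h; have hm := dir_maximal h.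
by split=> //; apply: maximal_ray_connected hm.
Qed.

(** The Pasch condition in terms of points. Its non-antipodality clause also ranges over pairs of
    equal rays, which [opposite_irrefl] settles. *)
Lemma pasch_points A B C D E : pasch_condition s ->
  joined A B -> joined A E -> joined A D ->
  ~ opposite A B D -> ~ opposite A B E -> ~ opposite A E D ->
  s B D E -> dir A B C -> C <> A -> exists2 F, s C D F & dir A E F.
Proof.
move=> hp hB hE hD nBD nBE nED hBDE hC CA.
have ne X : joined A X -> X <> A by move=> [h _] e; apply: h.
have sub : [set dir A B; dir A E; dir A D] `<=` boundary s A.
  by move=> r [[|]|] ->; exact: dir_boundary.
have irr X : joined A X -> ~ opposite A X X.
  by move=> h; apply: opposite_irrefl (dir_refl _ _) => //; exact: ne.
have [|||||F [hF h]] := hp A _ _ _ sub _ B C D; last by exists F.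
- move=> r r' [[|]|] -> [[|]|] -> /antipodal_dir o;
    have o' := oppositeC o; first [contradiction|exact: irr o].
- by split; [exact: dir_refl|exact: ne].
- by [].
- by split; [exact: dir_refl|exact: ne].
- by exists E; split; [exact: dir_refl|].
Qed.

Lemma connected_joined A B :
  (forall X Y, connected_segment s (s X Y)) -> A <> B -> joined A B.
Proof. by move=> h AB; split. Qed.

(** * Lines in a regular space do not close up *)

Section Regular.
Context (hp : pasch_condition s)
  (hc : forall A B : T, connected_segment s (s A B)).

(* Otherwise [W] is a corner at which the line [A C] closes up with [s A W].
   Seen from a point [W2] on the prolongation of [s A W] beyond [W], distinct
   points of the ray from [A] through [C] that are not beyond [W] lie in
   distinct directions, whereas by Pasch at [W2] the direction of a point of
   [s C1 W], with [C1] in [s C W], meets [s A C1] as well. *)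
Lemma between_closed A C W : A <> C -> C <> W ->
  (forall X, s C W X -> X <> W -> s A X C) -> s A W C.
Proof.
move=> AC CW hX; apply: contrapT => nW.
have J := connected_joined hc.
have hAC := J _ _ AC; have hCW := J _ _ CW.
have hlt F X : s C W F -> s F W X -> X <> W -> s A X F.
  move=> hF hFX XW; apply: bt_subr (hX _ (bt_subr hF hFX) XW) _.
  exact: bt_inr hF hFX.
have rX X : s C W X -> X <> W -> dir A C X by move=> h XW; right; apply: hX.
have [X1 hX1 [X1C X1W]] := joined_dense hCW.
have nA : ~ s C W A.
  move=> hA; have [h|h] := bt_total hA hX1.
    by apply: X1C; apply: bt_anti (hX _ hX1 X1W) (btC h).
  by apply/AC/esym/(bt_anti (btC h)); apply/btC/hX.
have AW : A <> W by move=> e; apply: nA; rewrite e; exact: btR.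
have nrW : ~ dir A C W.
  move=> [h|//]; apply: X1C; apply: (bt_anti (hX _ hX1 X1W)).
  exact: bt_subr h (btC hX1).
have disj X : X <> A -> dir A C X -> ~ dir A W X.
  move=> XA h h'; apply: nrW; rewrite (dir_eq hAC XA h).
  exact: dirC.
have nq : ~ dir W C A by move=> [/btC|/btC].
have nop W2 : s A W2 W -> W2 <> W -> ~ opposite W C W2.
  move=> h2 W2W hop;
    have hop' : opposite W A W2 by apply: opposite_between h2 _ _.
  by apply: nq; apply: (opposite_uniq (J _ _ (nesym W2W)) (J _ _ (nesym CW))
    (J _ _ (nesym AW))); apply: oppositeC.
have [W2 hW2 [W2W hAW2]] := extend (J _ _ AW).
have W2A : W2 <> A by move=> e; case: hAW2 => + _; rewrite e.
have nrW2 : ~ dir A C W2 by move=> h; apply: (disj _ W2A h); right.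
(* If [W2] saw [F] and [F'] in one direction, comparing directions at [F] would put [A] on [s C W],
   put [W2] on the ray from [A] through [C], or make [C] and [W2] opposite at [W]. *)
have inj F F' : s C W F -> F <> W -> s A F F' -> F' <> F -> ~ dir W2 F F'.
  move=> hF FW hF' F'F hd.
  have FW2 : F <> W2 by move=> e; apply: nrW2; rewrite -e; apply: rX.
  have FA : F <> A.
    by move=> e; rewrite e in hF' F'F; apply: F'F; exact: bt_id hF'.
  have hFA := J _ _ FA; have hFW2 := J _ _ FW2; have hFW := J _ _ FW.
  have [h|h] := hd.
    have : dir F W2 A.
      have h1 : dir F W2 F' by left; apply: btC.
      have h2 : dir F A F' by left; apply: btC.
      by rewrite (dir_eq hFW2 F'F h1); apply/dirC.
    case=> h1.
      exact: nA (bt_subr hF (bt_inr h1 hW2)).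
    apply: nrW2; have hAF : dir A C F by apply: rX.
    by rewrite (dir_eq hAC FA hAF); left; apply: btC.
  have h1 : opposite F W2 A.
    apply: (opposite_dirr (J _ _ (nesym F'F)) _ (nesym FA)); last first.
      exact: opposite_between h (nesym FW2) F'F.
    by right; apply: btC.
  have [X hFX [XF XW]] := joined_dense hFW.
  have h2 : opposite F A W.
    apply: (opposite_dirr (joined_subl hFW hFX XF) _ (nesym FW)).
      by right.
    apply: opposite_between XF; last exact: nesym.
    exact: hlt hF hFX XW.
  have [h3|h3] := opposite_uniq hFA hFW2 hFW (oppositeC h1) h2.
    apply: (nop _ hW2 W2W).
    apply: (opposite_dirl (J _ _ (nesym FW)) _ CW); first by right; apply: btC.
    by apply: opposite_between h3 _ W2W.
  by apply: nrW2; apply: rX W2W; apply: bt_subr hF _.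
have inj2 Q F1 F2 : joined W2 Q -> s C W F1 -> F1 <> W -> s C W F2 -> F2 <> W ->
    opposite W2 Q F1 -> opposite W2 Q F2 -> F1 = F2.
  move=> hQ h1 F1W h2 F2W o1 o2; apply: contrapT => F12.
  have W2F F : s C W F -> F <> W -> W2 <> F.
    by move=> hF FW e; apply: nrW2; rewrite e; apply: rX.
  have hd := opposite_uniq hQ (J _ _ (W2F _ h1 F1W)) (J _ _ (W2F _ h2 F2W)) o1
    o2.
  have [h|h] := bt_split h1 h2.
    by apply: (inj F1 F2 _ _ _ (nesym F12) hd) => //;
      apply: hlt (bt_inl h1 h) _.
  by apply: (inj F2 F1 _ _ _ F12 (dirC hd)) => //; apply: hlt h F2W.
(* By [inj2] at most one point of [s D W] other than [W] is opposite to [Q] at [W2]. Starting from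
   it secures the non-opposition needed for Pasch at [W2]. *)
have avoid Q D : joined W2 Q -> s C W D -> D <> W -> exists D',
    [/\ s C W D', s D W D', D' <> W & forall F, s D' W F -> F <> D' -> F <> W ->
      ~ opposite W2 Q F].
  move=> hQ hD DW.
  have [[F [hF FW oF]]|nF] :=
    EM (exists F, [/\ s D W F, F <> W & opposite W2 Q F]).
    exists F; split=> //; first exact: bt_subr hD hF.
    move=> F' hF' F'F F'W oF'; apply: F'F.
    have hCF := bt_subr hD hF.
    by apply: inj2 oF' oF => //; apply: bt_subr hCF hF'.
  exists D; split=> //; first exact: btL.
  by move=> F hF FD FW oF; apply: nF; exists F.
have jW2 : joined W2 W by exact: J.
have [D1 [hD1 _ D1W good1]] := avoid _ _ jW2 (btL C W) CW.
have [C1 hC1' [C1D1 C1W]] := joined_dense (J _ _ D1W).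
have hC1 := bt_subr hD1 hC1'.
have W2C1 : W2 <> C1 by move=> e; apply: nrW2; rewrite e; apply: rX.
have [D2 [hD2 hD2' D2W good2]] := avoid _ _ (J _ _ W2C1) hC1 C1W.
have [F hF' [FD2 FW]] := joined_dense (J _ _ D2W).
have hF := bt_subr hD2 hF'.
have hFC1 := bt_subr hD2' hF'.
have W2F : W2 <> F by move=> e; apply: nrW2; rewrite e; apply: rX.
have C1D2 : s A F C1 by apply: hlt hFC1 FW.
have FC1 : F <> C1.
  by move=> e; apply: FD2; rewrite e in hF' *;
    apply: bt_anti (btC hD2') (btC hF').
(* From [W2], the points [W] and [A] have the same direction, so Pasch moves [F] on [s W C1] to [F']
   on [s A C1], against [inj]. *)
have [||||F' h1 h2] := pasch_points hp jW2 (J _ _ W2F) (J _ _ W2C1) _ _ _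
  (btC hFC1) _ (nesym W2A).
- exact: good1.
- apply: good1 FW; first exact: bt_subr hC1' hFC1.
  by move=> e; rewrite e in hFC1; apply/C1D1/esym/(bt_meet hC1' (btL _ _) hFC1).
- by move=> /oppositeC; apply: good2.
- by right; apply: btC.
have F'F : F' <> F by move=> e; rewrite e in h1;
  apply/FC1/esym/(bt_anti h1 C1D2).
exact: inj hF FW (bt_subl C1D2 h1) F'F h2.
Qed.

(** The points [X] of [s A W] with [A] between [P] and [X] form an initial part, which is cut by
    connectedness. A last point [M] of it is excluded by prolonging [s P M], a first point outside
    it by [between_closed]. *)
Lemma between_step P Q A W : P <> A -> Q <> A -> s P Q A -> s A W Q -> s P W A.
Proof.
move=> PA QA hA hQ; apply: contrapT => nW.
have J X Y : X <> Y -> joined X Y by split.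
have down X Y : s A W X -> s P X A -> s A X Y -> s P Y A.
  by move=> _ h1 h2; apply: bt_inr h1 h2.
have [[M [hM LM] hmax]|[M [hM nM] hmin]] :=
  connected_cut (@hc A W) (L := fun X => s P X A) (btR P A) nW down.
  have MA : M <> A.
    by move=> e; have := hmax _ hQ hA; rewrite e => /bt_id.
  have PM : P <> M by move=> e; apply: PA; rewrite -e in LM; apply/esym/bt_id.
  have [M' hM' [M'M _]] := extend (J _ _ PM).
  have LM' : s P M' A by apply: bt_subl hM' LM.
  have [h|h] := nested (J _ _ (nesym MA)) hM (bt_inl hM' LM).
    by apply: M'M; apply: bt_anti hM' (bt_subr LM (hmax _ h LM')).
  by apply: nW; apply: bt_inr LM' h.
have AM : A <> M by move=> e; apply: nM; rewrite -e; exact: btR.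
apply: nM; apply: (between_closed PA AM) => X hX XM.
apply: contrapT => nX; apply: XM.
have hAX := bt_subl hM hX; exact: bt_meet hM hX (hmin _ hAX nX).
Qed.

(** [between_step] pushes each of two close witnesses out to [Q] and [P] in turn. *)
Lemma regular_opposite A P Q : P <> A -> Q <> A -> opposite A P Q -> s P Q A.
Proof.
move=> PA QA /(opposite_close PA QA) [P' [Q' [hP hQ P'A Q'A h]]].
have h1 : s Q P' A by apply/btC/(between_step P'A Q'A).
by apply/btC/(between_step QA P'A).
Qed.

End Regular.

(** * Lines containing every ray through two of their points *)

Definition line_closed : Prop := forall A P X Y Z, joined A P ->
  line A P X -> line A P Y -> joined X Y -> dir X Y Z -> line A P Z.

(** In a regular space distinct points are always joined; on a sphere [Q] is the antipode of [P]. *)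
Definition unjoined_opposite : Prop := forall A P Q, joined A P -> joined A Q ->
  P <> Q -> ~ joined P Q -> opposite A P Q.

Lemma joined_neq A P : joined A P -> P <> A.
Proof. by move=> [h _] e; apply: h. Qed.

(** The line is generated by [X] if [A] and [X] are joined, and by [Y] otherwise; on a sphere [X] is
    then the antipode of [A]. *)
Lemma line_closedI :
  (forall A X Y Z, joined A X -> line A X Y -> joined X Y -> dir X Y Z ->
     line A X Z) ->
  (forall A X Y, A <> X -> ~ joined A X -> joined X Y ->
     joined A Y /\ forall Z, dir X Y Z -> line A Y Z) ->
  line_closed.
Proof.
move=> H1 H2 A P X Y Z hP lX lY hXY hZ; have [XA|XA] := EM (A = X).
  by rewrite -XA in hXY hZ; rewrite (line_eq hP hXY lY); constructor 2.
have [hX|hX] := EM (joined A X).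
  by rewrite (line_eq hP hX lX) in lY *; apply: H1 hZ.
by have [hY h] := H2 _ _ _ XA hX hXY; rewrite (line_eq hP hY lY); apply: h.
Qed.

(** If [X] separates [A] from [Y], it separates [A] from [Z], and [regular_opposite] puts [X] on
    [s A Z]. Otherwise [Y] lies in the direction from [X] to [A], and so does [Z]. *)
Lemma regular_line_closed : pasch_condition s ->
  (forall A B, connected_segment s (s A B)) -> line_closed.
Proof.
move=> hp hc; apply: line_closedI => [A X Y Z hX lY hXY hZ|A X Y AX []//].
have XA := joined_neq hX; have hXA := joinedC hX.
have [YA|YA] := EM (Y = A).
  by apply: line_back => //; rewrite -YA.
have hAY : joined A Y by split=> // e; apply: YA.
have back : dir X A Y -> line A X Z.
  move=> h; apply: line_back => //.
  by rewrite (dir_eq hXA (joined_neq hXY) h).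
have [[h|h]|h] := lineE hAY lY.
- by apply: back; left; apply: btC.
- have [->|ZX] := EM (Z = X); first exact: line_direction.
  have oXAY : opposite X A Y by apply: opposite_between h (nesym XA)
    (joined_neq hXY).
  have oXAZ := opposite_dirr hXY hZ ZX oXAY.
  by constructor 2; right; apply: regular_opposite oXAZ => //; exact: nesym.
- by apply: back; right; apply: regular_opposite.
Qed.

(** * Great circles in a spherical space *)

Section Spherical.
Context (a : T -> T) (hs : is_spherical_pasch s a).

Lemma antipode_not_joined A : ~ joined A (a A).
Proof.
move=> h; have [Z hZ [ZA ZaA]] := joined_dense h.
have AaA : A <> a A by move=> e; exact: (spherical_nofix hs (esym e)).
have [X [Y [XY e]]] := spherical_pair hs (spherical_invol hs A).
have hA : [set X; Y] A by rewrite -e; exact: btL.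
have haA : [set X; Y] (a A) by rewrite -e; exact: btR.
have {}hZ : [set X; Y] Z by rewrite -e.
by case: hA haA hZ => [] eA [] eA' [] eZ; congruence.
Qed.

Lemma joined_sphericalE A B : joined A B <-> A <> B /\ B <> a A.
Proof.
split=> [h|[AB BaA]]; last by split=> //; apply: spherical_connected hs _ _ BaA.
by split=> [|e]; [case: h|apply: (@antipode_not_joined A); rewrite -e].
Qed.

Lemma joined_antipode A P : joined A P -> joined A (a P).
Proof.
move=> /joined_sphericalE [AP PaA]; apply/joined_sphericalE; split=> e.
  by apply: PaA; rewrite e (spherical_invol hs).
by apply: AP; rewrite -(spherical_invol hs A) -e (spherical_invol hs).
Qed.

Lemma opposite_antipode A P : joined A P -> opposite A P (a P).
Proof.
move=> h; have h' := joined_antipode h.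
apply/antipodal_dir/(spherical_rays hs (dir_maximal h) (dir_maximal h')).
by exists P; split; [left|right]; exact: dir_refl.
Qed.

Lemma antipode_seg A B C : s A B C -> s (a A) (a B) (a C).
Proof. by move=> h; rewrite -(spherical_seg hs); exists C. Qed.

(** At [X], both [Z] and [a A] are opposite to [A], hence in one direction. If [Z] comes first, then
    [X] and [A] share a direction at [Z]. If [a A] comes first, the antipodal map puts [A] between
    [a X] and [a Z], so [X] and [a Z] share a direction at [A]. *)
Lemma line_forward A X Z : joined A X -> opposite X A Z -> line A X Z.
Proof.
move=> h o; have [->|ZX] := EM (Z = X); first exact: line_direction.
have [->|ZA] := EM (Z = A); first exact: line_origin.
have hXA := joinedC h; have hXaA := joined_antipode hXA.
have [ZaA|ZaA] := EM (Z = a A).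
  by constructor 4; rewrite ZaA => co; apply: (@antipode_not_joined A);
    split=> // e; apply: ZA; rewrite ZaA -e.
have hAZ : joined A Z by apply/joined_sphericalE; split=> //; exact: nesym.
have [XZ|XZ] := EM (joined X Z); last first.
  have {}ZX : Z = a X.
    by apply: contrapT => e; apply: XZ; apply/joined_sphericalE; split=> //;
      exact: nesym.
  by constructor 3; rewrite ZX; exact: opposite_antipode.
have [hd|hd] := opposite_uniq hXA XZ hXaA o (opposite_antipode hXA); last first.
  have XA := joined_neq h.
  have o1 : opposite Z X (a A) by apply: opposite_between hd (nesym ZX) (nesym
    ZaA).
  have hZA := joinedC hAZ.
  have [hd'|hd'] := opposite_uniq (joined_antipode hZA) (joinedC XZ) hZA
    (oppositeC o1)
    (oppositeC (opposite_antipode hZA)).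
    by constructor 3; apply: opposite_between (btC hd') (joined_neq h) ZA.
  by constructor 2; right; apply: btC.
have h2 := antipode_seg hd; rewrite (spherical_invol hs) in h2.
have hAaX := joined_antipode h; have hAaZ := joined_antipode hAZ.
have o2 := opposite_between h2 (joined_neq hAaX) (joined_neq hAaZ).
have hd2 := opposite_uniq hAaX h hAaZ (oppositeC (opposite_antipode h)) o2.
constructor 3; apply: opposite_dirl hAaZ (dirC hd2) (joined_neq h) _.
exact: oppositeC (opposite_antipode hAZ).
Qed.

Lemma spherical_line_closed : line_closed.
Proof.
have H A X Y Z : joined A X -> line A X Y -> joined X Y -> dir X Y Z ->
    line A X Z.
  move=> hX lY hXY hZ.
  have XA := joined_neq hX; have hXA := joinedC hX.
  have [YA|YA] := EM (Y = A); first by apply: line_back => //; rewrite -YA.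
  have [->|ZX] := EM (Z = X); first exact: line_direction.
  have YX := joined_neq hXY.
  have forward : opposite X A Y -> line A X Z.
    by move=> o; apply: line_forward => //; apply: opposite_dirr o.
  have back : dir X A Y -> line A X Z.
    by move=> h; apply: line_back => //; rewrite (dir_eq hXA YX h).
  have [YaA|YaA] := EM (Y = a A).
    by apply: forward; rewrite YaA; exact: opposite_antipode.
  have hAY : joined A Y by apply/joined_sphericalE; split=> //; exact: nesym.
  have [[h|h]|h] := lineE hAY lY.
  - by apply: back; left; apply: btC.
  - exact/forward/(opposite_between h (nesym XA) YX).
  have hAaX := joined_antipode hX.
  have YaX : Y <> a X by move=> e; apply: (@antipode_not_joined X); rewrite -e.
  have hYX := joinedC hXY; have hYA := joinedC hAY.
  have aXA := joined_neq hAaX.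
  (* At [A], both [Y] and [a X] are opposite to [X]. If [a X] comes first, the antipodal map puts
     [X] between [a A] and [a Y]; if [Y] comes first, directions at [Y] are compared. *)
  have [hd|hd] := opposite_uniq hX hAY hAaX h (opposite_antipode hX).
    have h2 := antipode_seg hd; rewrite (spherical_invol hs) in h2.
    have aYX : a Y <> X by move=> e; apply: YaX;
      rewrite -e (spherical_invol hs).
    have aAX : a A <> X.
      by move=> e; apply: (@antipode_not_joined A); rewrite e.
    have hXaY := joined_antipode hXY.
    have o1 := opposite_between h2 aAX aYX.
    have hd2 := opposite_uniq (joined_antipode hXA) hXA hXaY
      (oppositeC (opposite_antipode hXA)) o1.
    apply/forward/(opposite_dirl hXaY (dirC hd2) (nesym XA)).
    exact: oppositeC (opposite_antipode hXY).
  have o1 : opposite Y A (a X) by apply: opposite_between hd _ (nesym YaX);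
    exact: nesym.
  have := opposite_uniq (joined_antipode hYX) hYA hYX (oppositeC o1)
    (oppositeC (opposite_antipode hYX)).
  case=> hd'; last by apply: back; right; apply: btC.
  exact/forward/(opposite_between (btC hd') (nesym XA) YX).
apply: line_closedI => // A X Y AX nj hXY.
have XaA : X = a A.
  by apply: contrapT => e; apply: nj; apply/joined_sphericalE.
have hAY : joined A Y.
  apply/joined_sphericalE; rewrite -XaA; split; last exact: joined_neq hXY.
  by move=> e; apply: nj; rewrite e; exact: joinedC.
have hYX := joinedC hXY; have hYA := joinedC hAY.
split=> // Z hZ; have [->|ZY] := EM (Z = Y); first exact: line_direction.
case: hZ => h.
  apply: (H A Y X Z) => //; last by left; apply: btC.
  by constructor 4 => co; apply: nj.
have YZ : joined Y Z.
  have h' := joined_interior h (joined_neq hXY) (nesym ZY).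
  exact: joined_sub h' h (btR _ _) (nesym ZY).
have o := opposite_between h (nesym (joined_neq hXY)) ZY.
have oXA : opposite Y X A by rewrite XaA; exact/oppositeC/opposite_antipode.
by apply: line_back => //; exact: opposite_uniq oXA o.
Qed.

Lemma spherical_unjoined : unjoined_opposite.
Proof.
move=> A P Q hP hQ PQ nj.
have -> : Q = a P by apply: contrapT => e; apply: nj; apply/joined_sphericalE.
exact: opposite_antipode.
Qed.

End Spherical.

(** * Triangles with vertex [A] *)

Section Plane.
Context (hp : pasch_condition s) (hV : unjoined_opposite) (hline : line_closed).

(** A proper triangle; the notion is independent of the chosen vertex by [genericC] and
    [generic_rot]. *)
Definition generic A B C : Prop := [/\ joined A B, joined A C & ~ line A B C].

Lemma genericC A B C : generic A B C -> generic A C B.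
Proof. by move=> [hB hC n]; split=> // h; apply/n/lineC. Qed.

Lemma generic_neq A B C : generic A B C -> B <> C.
Proof. by move=> [_ _ n] e; apply: n; rewrite -e; exact: line_direction. Qed.

Lemma generic_joined A B C : generic A B C -> joined B C.
Proof.
move=> g; have [hB hC n] := g; apply: contrapT => nj; apply: n; constructor 3.
exact: hV hB hC (generic_neq g) nj.
Qed.

Lemma generic_line A B C C' : generic A B C -> joined A C' -> line A C C' ->
  generic A B C'.
Proof.
move=> [hB hC n] hC' h; split=> // h'; apply: n.
by rewrite (line_eq hB hC' h'); apply: lineC.
Qed.

(** If [C] were on the line [B A], closedness of the line [A B] would put first [C'] and then [C] on
    it. *)
Lemma generic_rot A B C : generic A B C -> generic B A C.
Proof.
move=> g; have [hB hC n] := g; have hBC := generic_joined g.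
have hBA := joinedC hB; split=> // l; apply: n.
have [|/(opposite_close (joined_neq hBA) (joined_neq hBC))] := lineE hBC l.
  exact: line_back.
move=> [A' [C' [hA' hC' A'B C'B h]]].
have hBA' := joined_subl hBA hA' A'B; have hBC' := joined_subl hBC hC' C'B.
have lA' : line A B A' by constructor 2; left; apply: btC.
have lC' : line A B C'.
  apply: (hline hB lA' (line_direction A B) (joinedC hBA')).
  by right.
by apply: (hline hB (line_direction A B) lC' hBC'); right.
Qed.

Lemma generic_intro A B C E : generic A B C -> joined B E -> dir B E C ->
  generic A B E.
Proof.
move=> [hB hC n] hE hd.
have nE : ~ line A B E by move=> h;
  apply/n/(hline hB (line_direction A B) h hE).
split=> //; apply: contrapT => nj; apply: nE.
have [->|EA] := EM (E = A); first exact: line_origin.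
by constructor 4 => co; apply: nj; split=> // e; apply: EA.
Qed.

Lemma generic_in A B C E : generic A B C -> s B C E -> E <> B -> generic A B E.
Proof.
move=> g hE EB; apply: (generic_intro g); last by right.
exact: joined_subl (generic_joined g) hE EB.
Qed.

Lemma generic_mem A B C E : generic A B C -> s B C E -> joined A E.
Proof.
move=> g hE; have [->|EB] := EM (E = B); first by case: g.
by have [] := generic_in g hE EB.
Qed.

(** This is what makes projection from [A] injective on the opposite side. *)
Lemma generic_inj A B C E E' : generic A B C -> s B C E -> s B C E' ->
  E <> E' -> generic A E E'.
Proof.
have aux X Y : generic A B C -> s B C X -> s B C Y -> X <> Y -> s B X Y ->
    generic A X Y.
  move=> g hX hY XY h; apply: (@generic_in _ _ B); last exact: nesym.
    apply/genericC/(generic_in g hX) => e; apply: XY; rewrite e in h *.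
    exact/esym/bt_id.
  exact: btC.
move=> g hE hE' EE'; have [h|h] := bt_total hE hE'; first exact: aux.
by apply/genericC/aux => //; exact: nesym.
Qed.

Lemma generic_opposite A B C : generic A B C -> ~ opposite A B C.
Proof. by move=> [_ _ n] h; apply: n; constructor 3. Qed.

Lemma generic_dir A B C : generic A B C -> ~ dir A B C.
Proof. by move=> [_ _ n] h; apply: n; constructor 2. Qed.

(** In a triangle the non-opposition hypotheses of [pasch_points] hold as soon as [E] is not a
    vertex. *)
Lemma generic_pasch A B C D E : generic A B D -> s B D E -> dir A B C ->
  C <> A -> exists2 F, s C D F & dir A E F.
Proof.
move=> g hE hC CA; have [hB hD n] := g.
have [->|EB] := EM (E = B); first by exists C => //; exact: btL.
have [->|ED] := EM (E = D).
  by exists D; [exact: btR|exact: dir_refl].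
have gB := generic_in g hE EB; have gD := generic_in (genericC g) (btC hE) ED.
have [_ hAE _] := gB.
apply: (pasch_points hp hB hAE hD) => //; first exact: generic_opposite g.
  exact: generic_opposite gB.
exact: generic_opposite (genericC gD).
Qed.

(* The directions around [A] come in the cyclic order [B], [E], [C], [B']. *)
Lemma generic_turn A B C E B' : generic A B C -> s B C E -> E <> B -> E <> C ->
  s B B' A -> B' <> A -> exists2 G, s E B' G & dir A C G.
Proof.
move=> g hE EB EC hA B'A; have [hAB hAC _] := g.
have hBA := joinedC hAB.
have hBB' : joined B B' by apply: joined_interior hA (joined_neq hBA) (nesym
  B'A).
have hAB' : joined A B' by apply: joined_sub hBB' hA (btR _ _) (nesym B'A).
have lB' : line A B B'.
  by constructor 3; apply: opposite_between hA _ B'A; exact: joined_neq hAB.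
have gBCB' : generic B C B'.
  apply: (generic_line (genericC (generic_rot g)) hBB').
  by constructor 2; right.
have gB'BC := generic_rot (genericC gBCB').
have gABE := generic_in g hE EB.
have gAEB' := generic_line (genericC gABE) hAB' lB'.
have gACE := generic_in (genericC g) (btC hE) EC.
have dBE : dir C B E by left; apply: btC.
have dB'BA : dir B' B A by left; apply: btC.
(* Pasch at [C] gives [G] on [s E B'] and on the line [A C]; Pasch at [B'] gives [G'] on [s A C] in
   the direction of [E]. *)
have [G hG1 dG] := generic_pasch (generic_rot gBCB') hA dBE EC.
have [G' hline' dG'] := generic_pasch gB'BC hE dB'BA (nesym B'A).
have hAG := generic_mem gAEB' hG1.
have lG : line A C G by exact: line_back.
have [dCG|oCG] := lineE hAG lG; first by exists G.
have hB'A := joinedC hAB'.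
have G'A : G' <> A.
  move=> e; rewrite e in dG'.
  apply: (generic_dir (generic_in gB'BC hE EB)).
  exact: dir_trans hB'A (dirC dB'BA) (dirC dG').
have dCG' : dir A C G' by left.
case: dG' => h; first by exists G' => //; apply: btC.
(* Now [E] lies between the points [G] and [G'] of the line [A C], hence on that line. *)
have hGG'E := bt_inl h (btC hG1).
have EG : E <> G by move=> e; apply: (generic_opposite gACE); rewrite e.
have EG' : E <> G' by move=> e; apply: (generic_dir gACE); rewrite e.
case: gACE => _ _ []; apply: (hline hAC lG _ (joined_interior hGG'E EG EG')).
  by constructor 2.
by left.
Qed.

(** Pasch at [B] slides [D] towards [A] onto the ray from [B] through [C], where sides starting at
    [B] can be compared. *)
Lemma generic_nested A B C D E F : generic A B C -> generic A B D ->
  s B C E -> E <> B -> s B D F -> F <> B -> s A F E -> E <> A ->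
  exists D', [/\ dir A D D', D' <> A & dir B C D'].
Proof.
move=> gC gD hE EB hF FB hAFE EA.
have gABE := generic_in gC hE EB; have gABF := generic_in gD hF FB.
have gBFA := genericC (generic_rot gABF).
have hBF : dir B F D by right.
have DB : D <> B by move=> e; apply: (generic_neq gD).
have [D' hD' dD'] := generic_pasch gBFA (btC hAFE) hBF DB.
exists D'; split; first by left; apply: btC.
  by move=> e; apply: (generic_dir (generic_rot gABE)); apply: dirC; rewrite -e.
by apply: dir_trans (generic_joined gABE) _ dD'; right.
Qed.

Lemma generic_extend A B C : generic A B C ->
  exists C', [/\ s B C' C, C' <> C & generic A B C'].
Proof.
move=> g; have [C' hC' [C'C hBC']] := extend (generic_joined g).
by exists C'; split=> //; apply: generic_intro g hBC' _; left.
Qed.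

(** * The boundary at infinity *)

Section Boundary.
Context (A : T).
Implicit Types (u v w x y : boundary s A).
Local Notation bs := (@boundary_between T s A).
Local Notation anti u v := (antipodal_rays s A (val u) (val v)).

Lemma direction_maximal u : maximal_ray s A (val u).
Proof. by have [] := set_valP u. Qed.

Lemma direction_point u : exists2 P, val u P & P <> A.
Proof. by have [hr _] := direction_maximal u; apply: ray_other hr. Qed.

Lemma direction_joined u P : val u P -> P <> A -> joined A P.
Proof. by have [hr _] := direction_maximal u; apply: ray_joined. Qed.

Lemma direction_dir u P : val u P -> P <> A -> val u = dir A P.
Proof. exact/maximal_rayE/direction_maximal. Qed.

Lemma direction_eq u v P : val u P -> val v P -> P <> A -> u = v.
Proof.
by move=> hu hv PA; apply: val_inj;
  rewrite (direction_dir hu PA) (direction_dir hv PA).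
Qed.

Lemma direction_of P : joined A P -> exists u, val u P.
Proof.
move=> h; exists (exist _ (dir A P) (mem_set (dir_boundary h))).
exact: dir_refl.
Qed.

Lemma anti_opposite u v P Q : val u P -> P <> A -> val v Q -> Q <> A ->
  anti u v <-> opposite A P Q.
Proof.
move=> hu PA hv QA; rewrite (direction_dir hu PA) (direction_dir hv QA).
exact: antipodal_dir.
Qed.

Lemma antiC u v : anti u v -> anti v u.
Proof.
have [P hP PA] := direction_point u; have [Q hQ QA] := direction_point v.
by rewrite (anti_opposite hP PA hQ QA) (anti_opposite hQ QA hP PA) =>
  /oppositeC.
Qed.

Lemma anti_irrefl u : ~ anti u u.
Proof.
have [P hP PA] := direction_point u; rewrite (anti_opposite hP PA hP PA).
by apply: opposite_irrefl => //;
  [exact: direction_joined hP PA|exact: dir_refl].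
Qed.

Lemma anti_uniq u v w : anti u v -> anti u w -> v = w.
Proof.
have [P hP PA] := direction_point u; have [Q hQ QA] := direction_point v.
have [R hR RA] := direction_point w.
rewrite (anti_opposite hP PA hQ QA) (anti_opposite hP PA hR RA) => o1 o2.
apply: (direction_eq (P := R)) => //; rewrite (direction_dir hQ QA).
exact: opposite_uniq (direction_joined hP PA) (direction_joined hQ QA)
  (direction_joined hR RA) o1 o2.
Qed.

Lemma anti_exists u : exists v, anti u v.
Proof.
have [P hP PA] := direction_point u.
have [Q [hQ _ o]] := opposite_exists (direction_joined hP PA).
have [v hv] := direction_of hQ; exists v.
exact/(anti_opposite hP PA hv (joined_neq hQ)).
Qed.

(** General position; by [skewE] it amounts to being [joined] in the boundary. *)
Definition skew u v : Prop := ~ anti u v /\ u <> v.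

Lemma skew_generic u v P Q : val u P -> P <> A -> val v Q -> Q <> A ->
  skew u v <-> generic A P Q.
Proof.
move=> hu PA hv QA.
have jP := direction_joined hu PA; have jQ := direction_joined hv QA.
split=> [[na ne]|g].
  split=> // /(lineE jQ) [h|/(anti_opposite hu PA hv QA)//].
  by apply/ne/(direction_eq (P := Q)) => //; rewrite (direction_dir hu PA).
split; first by move/(anti_opposite hu PA hv QA); exact: generic_opposite.
move=> e; apply: (generic_dir g); rewrite -(direction_dir hu PA) e //.
Qed.

Lemma between_degenerate u v : anti u v \/ u = v -> bs u v = [set u; v].
Proof. by rewrite /boundary_between; case: asboolP. Qed.

Lemma between_same u : bs u u = [set u].
Proof. by rewrite between_degenerate ?setUid//; right. Qed.

(* Central projection from [A]: for rays in general position it is enough to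
   look at one segment joining them. *)
Lemma between_skew u v B C w : generic A B C -> val u B -> val v C ->
  bs u v w <-> exists2 E, s B C E & val w E.
Proof.
move=> g hB hC; have [jB jC _] := g.
have BA := joined_neq jB; have CA := joined_neq jC.
have [na ne] : skew u v by apply/(skew_generic hB BA hC CA).
rewrite /boundary_between; case: asboolP => [[]//|_]; split=> [h|[E hE hw]].
  by have [E [hw hE]] := h _ _ hB hC; exists E.
move=> B' C' hB' hC'.
have wA : val w A by have [hr _] := direction_maximal w; apply: ray_origin hr.
have [->|B'A] := EM (B' = A); first by exists A; split=> //; exact: btL.
have [->|C'A] := EM (C' = A); first by exists A; split=> //; exact: btR.
have jE := generic_mem g hE; have EA := joined_neq jE.
have dB : dir A B B' by rewrite -(direction_dir hB BA).
have dC : dir A C C' by rewrite -(direction_dir hC CA).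
have [F hF dF] := generic_pasch g hE dB B'A.
have gB'C : generic A B' C by apply/(skew_generic hB' B'A hC CA).
have FA := joined_neq (generic_mem gB'C hF).
have [F' hF' dF'] := generic_pasch (genericC gB'C) (btC hF) dC C'A.
exists F'; split; last exact: btC.
by rewrite (direction_dir hw EA) (dir_eq jE FA dF).
Qed.

Lemma between_projection B C E F w x y : generic A B C -> s B C E -> s B C F ->
  val w E -> val x F -> bs w x y <-> exists2 G, s E F G & val y G.
Proof.
move=> g hE hF hw hx.
have EA := joined_neq (generic_mem g hE).
have [e|EF] := EM (E = F); last first.
  exact: between_skew (generic_inj g hE hF EF) hw hx.
rewrite -e in hx *; rewrite (direction_eq hx hw EA) between_same; split.
  by move=> ->; exists E => //; exact: btL.
by move=> [G /bt_id -> hy]; apply: direction_eq hy hw EA.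
Qed.

Lemma projection_inj B C E F w : generic A B C -> s B C E -> s B C F ->
  val w E -> val w F -> E = F.
Proof.
move=> g hE hF hwE hwF; apply: contrapT => EF; have g' :=
  generic_inj g hE hF EF.
by apply: (generic_dir g'); rewrite -(direction_dir hwE) //;
  case: g' => /joined_neq.
Qed.

Lemma skew_points u v : skew u v ->
  exists B C, [/\ generic A B C, val u B & val v C].
Proof.
have [B hB BA] := direction_point u; have [C hC CA] := direction_point v.
by move=> h; exists B, C; split=> //; apply/(skew_generic hB BA hC CA).
Qed.

Lemma skew_points_from u v B : skew u v -> val u B -> B <> A ->
  exists2 C, generic A B C & val v C.
Proof.
move=> h hB BA; have [C hC CA] := direction_point v.
by exists C => //; apply/(skew_generic hB BA hC CA).
Qed.

Lemma generic_skew u v B C : generic A B C -> val u B -> val v C -> skew u v.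
Proof.
by move=> g hB hC; have [/joined_neq BA /joined_neq CA _] := g;
  apply/(skew_generic hB BA hC CA).
Qed.

(** Segments between equal or antipodal rays are checked directly; all others are projections of
    segments of the space. *)
Lemma boundary_betweenness : is_betweenness bs.
Proof.
split.
- move=> u v; have [h|/not_orP h] := EM (anti u v \/ u = v).
    by rewrite between_degenerate //; left.
  have [B [C [g hB hC]]] := skew_points h.
  by apply/(between_skew _ g hB hC); exists B => //; exact: btL.
- move=> w u v; have [h|/not_orP h] := EM (anti u v \/ u = v).
    rewrite !between_degenerate //; first by rewrite setUC.
    by case: h => [/antiC|]; [left|right].
  have [B [C [g hB hC]]] := skew_points h.
  move=> /(between_skew _ g hB hC) [E hE hw].
  by apply/(between_skew _ (genericC g) hC hB); exists E => //; exact: btC.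
- move=> u v w; have [h|/not_orP h] := EM (anti u v \/ u = v).
    have e := between_degenerate h; rewrite e => -[] /= ->.
      by rewrite e between_same setUA setUid.
    by rewrite e between_same -setUA setUid.
  have [B [C [g hB hC]]] := skew_points h.
  move=> /(between_skew _ g hB hC) [E hE hw].
  have hBE y := between_projection y g (btL B C) hE hB hw.
  have hEC y := between_projection y g hE (btR B C) hw hC.
  rewrite eqEsubset; split=> y.
    move=> /(between_skew _ g hB hC) [G hG hy].
    by have [hG'|hG'] := bt_split hE hG; [left; apply/hBE|right; apply/hEC];
      exists G.
  move=> [/hBE|/hEC] [G hG hy]; apply/(between_skew _ g hB hC); exists G => //.
    exact: bt_subl hE hG.
  exact: bt_subr hE hG.
- move=> u v w H; rewrite between_same; split=> //.
  have [h|/not_orP h] := EM (anti u v \/ u = v).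
    move: H; have e := between_degenerate h; rewrite e => -[] /= ->.
      by rewrite e between_same; apply/setIidPl => z ->; left.
    by rewrite e between_same; apply/setIidPr => z ->; right.
  have [B [C [g hB hC]]] := skew_points h.
  move: H => /(between_skew _ g hB hC) [E hE hw].
  have hBE y := between_projection y g (btL B C) hE hB hw.
  have hEC y := between_projection y g hE (btR B C) hw hC.
  rewrite eqEsubset; split=> y; last first.
    move=> ->; split; [apply/hBE|apply/hEC]; exists E => //;
      [exact: btR|exact: btL].
  move=> [/hBE [G hG hy] /hEC [G' hG' hy']].
  have e := projection_inj g (bt_subl hE hG) (bt_subr hE hG') hy hy'.
  rewrite -e in hG'; have eE := bt_meet hE hG hG'; rewrite eE in hy.
  exact: direction_eq hy hw (joined_neq (generic_mem g hE)).
Qed.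

Lemma between_left u v : bs u v u.
Proof. by have [h _ _ _] := boundary_betweenness; apply: h. Qed.

Lemma between_comm u v w : bs u v w -> bs v u w.
Proof. by have [_ h _ _] := boundary_betweenness; apply: h. Qed.

Lemma skew_connected u v : skew u v -> connected_segment bs (bs u v).
Proof.
move=> h; have [B [C [g hB hC]]] := skew_points h.
(* [pts X] is the preimage of [X] under projection. It preserves convexity and being a segment, so a
   splitting of the segment of [u] and [v] pulls back to [s B C]. *)
pose pts (X : set (boundary s A)) : set T :=
  [set E | s B C E /\ exists2 w, X w & val w E].
have lift E : s B C E -> exists2 w, bs u v w & val w E.
  move=> hE; have [w hw] := direction_of (generic_mem g hE).
  by exists w => //; apply/(between_skew _ g hB hC); exists E.
have proj w : bs u v w -> exists2 E, s B C E & val w E.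
  by move/(between_skew _ g hB hC).
have same E w x : s B C E -> val w E -> val x E -> w = x.
  by move=> hE hw hx; apply: direction_eq hw hx (joined_neq (generic_mem g hE)).
have pts_convex (X : set (boundary s A)) : convex_set bs X ->
  convex_set s (pts X).
  move=> cX E F [hE [w Xw hw]] [hF [x Xx hx]] G hG.
  have hBG := bt_sub hE hF hG; split=> //.
  have [y _ hy] := lift _ hBG; exists y => //; apply: cX Xw Xx _ _.
  by apply/(between_projection _ g hE hF hw hx); exists G.
have pts_segment (X : set (boundary s A)) : X `<=` bs u v ->
  is_segment s (pts X) <-> is_segment bs X.
  move=> sX; split=> [[E [F e]]|[w [x e]]].
    have [hE [w Xw hw]] : pts X E by rewrite e; exact: btL.
    have [hF [x Xx hx]] : pts X F by rewrite e; exact: btR.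
    exists w, x; rewrite eqEsubset; split=> y.
      move=> Xy; have [G hG hy] := proj _ (sX _ Xy).
      apply/(between_projection _ g hE hF hw hx); exists G => //.
      by rewrite -e; split=> //; exists y.
    move=> /(between_projection _ g hE hF hw hx) [G]; rewrite -e.
    by move=> [hG [y' Xy' hy']] hy; rewrite (same _ _ _ hG hy hy').
  have Xw : X w by rewrite e; apply: between_left.
  have Xx : X x.
    by rewrite e; apply/between_comm/between_left.
  have [E hE hw] := proj _ (sX _ Xw); have [F hF hx] := proj _ (sX _ Xx).
  exists E, F; rewrite eqEsubset; split=> G.
    move=> [hG [y Xy hy]]; move: Xy; rewrite e.
    move=> /(between_projection _ g hE hF hw hx) [G' hG' hy'].
    by rewrite (projection_inj g hG (bt_sub hE hF hG') hy hy').
  move=> hG; have hBG := bt_sub hE hF hG; split=> //.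
  have [y _ hy] := lift _ hBG; exists y => //; rewrite e.
  by apply/(between_projection _ g hE hF hw hx); exists G.
move=> C1 C2 cC1 cC2 [w Cw] [x Cx] C12 e.
have s1 : C1 `<=` bs u v by rewrite e; left.
have s2 : C2 `<=` bs u v by rewrite e; right.
rewrite -(pts_segment _ s1) -(pts_segment _ s2).
have [E hE hw] := proj _ (s1 _ Cw); have [F hF hx] := proj _ (s2 _ Cx).
have [_ co] := generic_joined g; apply: co;
  [exact: pts_convex|exact: pts_convex| | | |].
- by exists E; split=> //; exists w.
- by exists F; split=> //; exists x.
- rewrite -subset0 => G [[hG [y Cy hy]] [_ [y' Cy' hy']]].
  rewrite -(same _ _ _ hG hy hy') in Cy'.
  by have : (C1 `&` C2) y by []; rewrite C12.
rewrite eqEsubset; split=> G; last by case=> -[].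
move=> hG; have [y] := lift _ hG; rewrite e => -[Cy|Cy] hy; [left|right];
  by split=> //; exists y.
Qed.

(** The pair splits into two singletons, both closed segments. *)
Lemma anti_not_connected u v : anti u v -> ~ connected_segment bs (bs u v).
Proof.
move=> h co; have uv : u <> v by move=> e; rewrite e in h; exact: anti_irrefl h.
have segm w : is_segment bs [set w] by exists w, w; rewrite between_same.
have conv w : convex_set bs [set w] by move=> _ _ -> ->; rewrite between_same.
have [||||[_ n]|[n _]] := co [set u] [set v] (conv u) (conv v).
- by exists u.
- by exists v.
- by rewrite -subset0 => w [-> e]; apply: uv.
- by rewrite between_degenerate //; left.
- exact: n (segm v).
exact: n (segm u).
Qed.

Lemma skew_interior u v : seg_interior bs u v !=set0 -> skew u v.
Proof.
move=> [w [hw nw]]; apply/not_orP => h.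
by apply: nw; rewrite between_degenerate in hw.
Qed.

(** Sides from a common point [B] to [v] and [w] cross the ray [x] at [E] and [F]. According to
    which is nearer to [A], [generic_nested] moves one end so that both sides lie on one ray from
    [B]. *)
Lemma boundary_nested u v w :
  seg_interior bs u v `&` seg_interior bs u w !=set0 ->
  bs u v `<=` bs u w \/ bs u w `<=` bs u v.
Proof.
move=> [x [[hv nv] [hw nw]]].
have suv : skew u v by apply: skew_interior; exists x.
have suw : skew u w by apply: skew_interior; exists x.
have xu : x <> u by move=> e; apply: nv; left.
have [B [C [gC hB hC]]] := skew_points suv.
have BA : B <> A by case: gC => /joined_neq.
have [D gD hD] := skew_points_from suw hB BA.
have [E hE hxE] : exists2 E, s B C E & val x E by exact/(between_skew _ gC hB
  hC).
have [F hF hxF] : exists2 F, s B D F & val x F by exact/(between_skew _ gD hB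
  hD).
have EA := joined_neq (generic_mem gC hE); have FA :=
  joined_neq (generic_mem gD hF).
have EB : E <> B by move=> e; apply: xu; rewrite e in hxE;
  apply: direction_eq hxE hB BA.
have FB : F <> B by move=> e; apply: xu; rewrite e in hxF;
  apply: direction_eq hxF hB BA.
have compare v' w' C' D' : generic A B C' -> generic A B D' -> val v' C' ->
  val w' D' ->
    dir B C' D' -> bs u v' `<=` bs u w' \/ bs u w' `<=` bs u v'.
  move=> gC' gD' hC' hD' [h|h]; [right|left] => y.
    move=> /(between_skew _ gD' hB hD') [G hG hy].
    by apply/(between_skew _ gC' hB hC'); exists G => //; apply: bt_subl h hG.
  move=> /(between_skew _ gC' hB hC') [G hG hy].
  by apply/(between_skew _ gD' hB hD'); exists G => //; apply: bt_subl h hG.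
have : dir A E F by rewrite -(direction_dir hxE EA).
move=> [h|h].
  have [C' [dC C'A dBC]] := generic_nested gD gC hF FB hE EB h FA.
  have hC' : val v C' by rewrite (direction_dir hC) //;
    case: gC => _ /joined_neq.
  have gC' : generic A B C' by exact/(skew_generic hB BA hC' C'A).
  by apply: compare gC' gD hC' hD (dirC dBC).
have [D' [dD D'A dBD]] := generic_nested gC gD hE EB hF FB h EA.
have hD' : val w D' by rewrite (direction_dir hD) //; case: gD => _ /joined_neq.
have gD' : generic A B D' by exact/(skew_generic hB BA hD' D'A).
exact: compare gC gD' hC hD' dBD.
Qed.

Lemma boundary_extend u v : u <> v -> connected_segment bs (bs u v) ->
  exists w x, connected_segment bs (bs w x) /\ bs u v `<=` seg_interior bs w x.
Proof.
move=> uv co; have [B [C [g hB hC]]] : exists B C,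
    [/\ generic A B C, val u B & val v C].
  by apply: skew_points; split=> // /anti_not_connected.
have [C' [hC' C'C gC']] := generic_extend g.
have [B' [hB' B'B gB']] := generic_extend (genericC gC').
have [_ jC' _] := gC'; have [_ jB' _] := gB'.
have [w hw] := direction_of jB'; have [x hx] := direction_of jC'.
have {}gB' := genericC gB'; have {}hB' := btC hB'.
exists w, x; split; first by apply: skew_connected;
  apply: generic_skew gB' hw hx.
move=> y /(between_skew _ g hB hC) [E hE hy].
have hB'C : s B' C' C by apply: bt_subr hB' hC'.
have hE' : s B' C' E := bt_sub hB' hB'C hE.
split; first by apply/(between_skew _ gB' hw hx); exists E.
move=> [] e; rewrite e in hy.
  have eE := projection_inj gB' hE' (btL _ _) hy hw; rewrite eE in hE.
  exact: B'B (bt_anti (btC hB') (btC (bt_subl hC' hE))).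
have eE := projection_inj gB' hE' (btR _ _) hy hx; rewrite eE in hE.
by apply: C'C; apply: bt_anti hC' hE.
Qed.

Lemma boundary_line_space : is_line_space bs.
Proof.
split; last by move=> u v /skew_interior/skew_connected.
split; [exact: boundary_betweenness|exact: boundary_nested|exact:
  boundary_extend].
Qed.

Lemma skewE u v : skew u v <-> u <> v /\ connected_segment bs (bs u v).
Proof.
split=> [h|[uv co]]; first by split; [case: h|exact: skew_connected].
by split=> // /anti_not_connected.
Qed.

Lemma skew_in u v w : skew u v -> bs u v w -> w <> u -> skew u w.
Proof.
move=> h hw wu; have [B [C [g hB hC]]] := skew_points h.
move: hw => /(between_skew _ g hB hC) [E hE hw].
apply: (generic_skew _ hB hw); apply: (generic_in g hE) => e.
rewrite e in hw; apply: wu; apply: direction_eq hw hB _.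
by case: g => /joined_neq.
Qed.

Lemma between_turn u u' v w : skew u v -> bs u v w -> w <> u -> w <> v ->
  anti u u' -> bs w u' v.
Proof.
move=> h hw wu wv o; have suw := skew_in h hw wu.
have [B [C [g hB hC]]] := skew_points h; have [jB jC _] := g.
move: hw => /(between_skew _ g hB hC) [E hE hw].
have EB : E <> B.
  by move=> e; rewrite e in hw; apply/wu/(direction_eq hw hB)/joined_neq.
have EC : E <> C.
  by move=> e; rewrite e in hw; apply/wv/(direction_eq hw hC)/joined_neq.
have [B' [jB' hA oB]] := opposite_exists jB; have B'A := joined_neq jB'.
have [x hx] := direction_of jB'.
have -> : u' = x.
  by apply: anti_uniq o _; apply/(anti_opposite hB (joined_neq jB) hx B'A).
have [G hG dG] := generic_turn g hE EB EC hA B'A.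
have gEB' : generic A E B'.
  apply: (generic_line (genericC (generic_in g hE EB)) jB').
  by constructor 3.
apply/(between_skew _ gEB' hw hx); exists G => //.
by rewrite (direction_dir hC (joined_neq jC)).
Qed.

(* Pasch condition of the boundary with apex [u]: seen from [A], it is the
   Pasch condition of the space with apex a point [B] of [u]. *)
Lemma between_pasch u f v v' x y : skew u f -> bs u f v -> bs u f v' ->
  v <> u -> v' <> u -> skew u x -> skew v x -> skew v' x -> skew u y ->
  bs v x y -> ~ bs u v x -> ~ bs u x v ->
  (forall c d, bs u v c -> c <> u -> bs u x d -> d <> u ->
     skew c d /\ ~ bs c d u) ->
  exists2 y', bs v' x y' & bs u y y' \/ bs u y' y.
Proof.
move=> suf hv hv' vu v'u sux svx sv'x suy hy nx nv nop.
have [B [F [gF hB hF]]] := skew_points suf; have [jB _ _] := gF.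
have BA := joined_neq jB.
move: (hv) => /(between_skew _ gF hB hF) [C hC hvC].
move: (hv') => /(between_skew _ gF hB hF) [C' hC' hvC'].
have CB : C <> B by move=> e; rewrite e in hvC; apply: vu;
  apply: direction_eq hvC hB BA.
have C'B : C' <> B.
  by move=> e; rewrite e in hvC'; apply: v'u; apply: direction_eq hvC' hB BA.
have gC := generic_in gF hC CB; have gC' := generic_in gF hC' C'B.
have CA : C <> A by case: gC => _ /joined_neq.
have C'A : C' <> A by case: gC' => _ /joined_neq.
have [D gD hD] := skew_points_from sux hB BA;
  have DA : D <> A by case: gD => _ /joined_neq.
have gCD : generic A C D by exact/(skew_generic hvC CA hD DA).
have gC'D : generic A C' D by exact/(skew_generic hvC' C'A hD DA).
move: hy => /(between_skew _ gCD hvC hD) [Y hY hyY].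
have YA := joined_neq (generic_mem gCD hY).
have gY : generic A B Y by exact/(skew_generic hB BA hyY YA).
(* If [D] were on the line [B C], then [x] or [v] would lie between [u] and the other, or [B] would
   lie between points of [s B C] and [s B D], which [nop] excludes. *)
have gBCD : generic B C D.
  split; [exact: generic_joined gC|exact: generic_joined gD|move=> l].
  have [[h|h]|o] := lineE (generic_joined gD) l.
  - by apply: nx; apply/(between_skew _ gC hB hvC); exists D.
  - by apply: nv; apply/(between_skew _ gD hB hD); exists C.
  have [C1 [D1 [hC1 hD1 C1B D1B hBB]]] :=
    opposite_close CB (joined_neq (generic_joined gD)) o.
  have [c hc] := direction_of (generic_mem gC hC1).
  have [d hd] := direction_of (generic_mem gD hD1).
  have [||||scd []] := nop c d.
  - by apply/(between_skew _ gC hB hvC); exists C1.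
  - by move=> e; rewrite e in hc; apply: C1B;
      apply: projection_inj gC hC1 (btL _ _) hc hB.
  - by apply/(between_skew _ gD hB hD); exists D1.
  - by move=> e; rewrite e in hd; apply: D1B;
      apply: projection_inj gD hD1 (btL _ _) hd hB.
  have g1 : generic A C1 D1.
    apply/(skew_generic hc _ hd) => //; apply: joined_neq.
      exact: generic_mem gC hC1.
    exact: generic_mem gD hD1.
  by apply/(between_skew _ g1 hc hd); exists B.
have dCC' : dir B C C' by have [?|?] := bt_total hC hC'; [left|right].
have [Y' hY' dY] := generic_pasch gBCD hY dCC' C'B.
have [y' hy'] := direction_of (generic_mem gC'D hY').
exists y'; first by apply/(between_skew _ gC'D hvC' hD); exists Y'.
case: dY => h; first by left; apply/(between_skew _ gY hB hyY); exists Y'.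
right; have gY' : generic A B Y'.
  have jY' : joined B Y' by exact: joined_supl (generic_joined gY) h.
  by apply: generic_intro gY jY' _; left.
by apply/(between_skew _ gY' hB hy'); exists Y.
Qed.

End Boundary.
End Plane.
End LineSpace.

(** * The antipodal map and the Pasch condition of the boundary *)

Section SphericalBoundary.
Context (T : Type) (s : T -> T -> set T) (hl : is_line_space s).
Context (hp : pasch_condition s) (hV : unjoined_opposite s)
  (hline : line_closed s) (A : T).
Context (a : boundary s A -> boundary s A).
Context (ha : forall u, antipodal_rays s A (val u) (val (a u))).
Implicit Types (u v w x y : boundary s A).
Local Notation bs := (@boundary_between T s A).
Local Notation anti u v := (antipodal_rays s A (val u) (val v)).

Let hbs : is_line_space bs.
Proof. exact: boundary_line_space. Qed.

Lemma antiE u v : anti u v <-> v = a u.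
Proof. by split=> [h|->//]; apply: (anti_uniq hl h (ha u)). Qed.

Lemma anti_invol u : a (a u) = u.
Proof. by apply/esym/antiE/(antiC hl). Qed.

Lemma anti_nofix u : a u <> u.
Proof. by move=> e; have := ha u; rewrite e; exact: anti_irrefl. Qed.

Lemma joined_boundary u v : joined bs u v <-> u <> v /\ v <> a u.
Proof.
split=> [/(skewE hl hp hV hline) [na uv]|[uv nv]].
  by split=> // /antiE.
by apply/(skewE hl hp hV hline); split=> // /antiE.
Qed.

Lemma boundary_turn u v w : joined bs u v -> bs u v w -> w <> u -> w <> v ->
  bs w (a u) v.
Proof. by move=> /(skewE hl hp hV hline) h ? ? ?;
  apply: between_turn h _ _ _ _. Qed.

Lemma joined_anti u v : joined bs u v -> joined bs u (a v).
Proof.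
move=> /joined_boundary [uv nv]; apply/joined_boundary; split=> e.
  by apply: nv; rewrite e anti_invol.
by apply: uv; rewrite -(anti_invol u) -e anti_invol.
Qed.

(** Three turns: [w] between [u] and [v], then [v] between [w] and [a u], then [a u] between [v] and
    [a w], then [a w] between [a u] and [a v]. *)
Lemma boundary_anti_seg u v w : bs u v w -> bs (a u) (a v) (a w).
Proof.
move=> hw; have [h|h] := EM (anti u v \/ u = v).
  have h' : anti (a u) (a v) \/ a u = a v.
    case: h => [/antiE->|->]; [left|by right].
    by rewrite anti_invol; apply/(antiC hl).
  rewrite between_degenerate // in hw; rewrite between_degenerate //.
  by case: hw => ->; [left|right].
have [->|wu] := EM (w = u); first exact: btL.
have [->|wv] := EM (w = v); first exact: btR.
have juv : joined bs u v.
  by apply/joined_boundary; split=> e; apply: h; [right|left; apply/antiE].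
have juw := joined_subl hbs juv hw wu.
have jvw := joined_subl hbs (joinedC hbs juv) (btC hbs hw) wv.
have aI x y : a x = a y -> x = y.
  by move=> e; rewrite -(anti_invol x) e anti_invol.
have neq x y : joined bs x y -> x <> a y.
  by move=> /joined_boundary [_ n] e; apply: n; rewrite e anti_invol.
have h1 := boundary_turn juv hw wu wv.
have h2 := boundary_turn (joined_anti (joinedC hbs juw)) h1 (nesym wv) (neq _ _
  (joinedC hbs juv)).
have := boundary_turn (joined_anti jvw) h2 _ _; apply.
  by apply/nesym/neq/(joinedC hbs).
by move=> /aI; exact: nesym.
Qed.

(** For [w] strictly between [u] and [v], one turn puts [u] between [w] and [a v]. *)
Lemma anti_rays u r1 r2 v : maximal_ray bs u r1 -> maximal_ray bs u r2 ->
  r1 v -> r2 (a v) -> antipodal_rays bs u r1 r2.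
Proof.
move=> [hr1 _] [hr2 _] hv hav.
have vu : v <> u.
  move=> e; rewrite e in hav.
  by have /joined_boundary [_] := ray_joined hbs hr2 hav (@anti_nofix u).
have avu : a v <> u.
  by move=> e; have /joined_boundary [_ []] := ray_joined hbs hr1 hv vu;
    rewrite -e anti_invol.
have juv := ray_joined hbs hr1 hv vu.
have [w hw [wu wv]] := joined_dense hbs juv.
exists w, (a v); split=> //.
  exact: (ray_convex hr1 (ray_origin hr1) hv hw).
split; last by case=> [/esym|/esym].
exact: boundary_turn (joinedC hbs juv) (btC hbs hw) wv wu.
Qed.

Lemma boundary_pasch_condition : pasch_condition bs.
Proof.
move=> u r1 r2 r3 sub nop v v' x [r1v vu] [r1v' v'u] [r3x xu] [y [r2y hy]].
have [m1 _] : boundary bs u r1 by apply: sub; left; left.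
have [m2 _] : boundary bs u r2 by apply: sub; left; right.
have [m3 _] : boundary bs u r3 by apply: sub; right.
have [hr1 _] := m1; have [hr2 _] := m2; have [hr3 _] := m3.
have n13 : ~ antipodal_rays bs u r1 r3 by apply: nop; [left; left|right].
have yu : y <> u.
  move=> e; apply: n13; exists v, x; split=> //.
  by rewrite -e; split=> // -[] e'; rewrite e in e'; [apply: vu|apply: xu].
(* If [r1] and [r3] share [x], convexity puts [y] on [r1], so [r2] equals [r1]. *)
have [r1x|r1x] := EM (r1 x).
  have r1y : r1 y by exact: (ray_convex hr1 r1v r1x).
  have -> : r2 = r1.
    by rewrite (maximal_rayE hbs m1 r1y yu) (maximal_rayE hbs m2 r2y yu).
  by exists x; split=> //; exact: btR.
have r31 z : r1 z -> z <> u -> ~ r3 z.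
  move=> r1z zu r3z; apply: r1x.
  by rewrite (maximal_rayE hbs m1 r1z zu) -(maximal_rayE hbs m3 r3z zu).
(* Antipodal points on [r1] and [r3] would make these rays antipodal by [anti_rays]. *)
have apart z t : r1 z -> z <> u -> r3 t -> joined bs z t.
  move=> r1z zu r3t; apply/joined_boundary; split=> e.
    by apply: (r31 z) => //; rewrite e.
  by apply: n13; apply: anti_rays m1 m3 r1z _; rewrite -e.
have [f [r1f hv hv']] := ray_top hbs hr1 r1v r1v'.
have fu : f <> u by move=> e; rewrite e in hv; apply: vu; apply: bt_id hv.
have J z t : joined bs z t -> skew z t by move/(skewE hl hp hV hline).
have JR r z : is_ray bs u r -> r z -> z <> u -> skew u z.
  by move=> hr hz zu; apply/J/(ray_joined hbs hr).
have [y' hy' dy] : exists2 y', bs v' x y' & bs u y y' \/ bs u y' y.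
  apply: (@between_pasch _ _ hl hp hV hline A u f v v' x y) => //.
  - exact: JR hr1 _ _.
  - exact: JR hr3 _ _.
  - exact/J/apart.
  - exact/J/apart.
  - exact: JR hr2 _ _.
  - by move=> h; apply: r1x; apply: (ray_convex hr1 (ray_origin hr1) r1v).
  - by move=> h; apply: (r31 v) => //;
      apply: (ray_convex hr3 (ray_origin hr3) r3x).
  move=> c d hc cu hd du.
  have r1c : r1 c by exact: (ray_convex hr1 (ray_origin hr1) r1v).
  have r3d : r3 d by exact: (ray_convex hr3 (ray_origin hr3) r3x).
  split; first exact/J/apart.
  move=> h; apply: n13; exists c, d; split=> //; split=> // -[] e.
    exact/cu/esym.
  exact/du/esym.
by exists y'; split=> //; rewrite (maximal_rayE hbs m2 r2y yu).
Qed.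

Lemma boundary_spherical : is_spherical_pasch bs a.
Proof.
split.
- by split; [exact: line_space hbs|exact: boundary_pasch_condition].
- exact: anti_invol.
- exact: anti_nofix.
- move=> u v; rewrite eqEsubset; split=> [_ [w hw <-]|w hw].
    exact: boundary_anti_seg.
  exists (a w); last exact: anti_invol.
  by have := boundary_anti_seg hw; rewrite !anti_invol.
- move=> u v vu; have [->|uv] := EM (u = v); first exact: connected_point.
  by have [_] : joined bs u v by apply/joined_boundary.
- move=> u v e; exists u, v; split; first by move=> uv;
    apply: (@anti_nofix v); rewrite e.
  by apply: between_degenerate; left; apply/(antiC hl); rewrite -e.
move=> u r1 r2 m1 m2 [v [hv hav]].
(* No ray contains [v] and [a v]: it would be antipodal to itself, against extremality of its
   origin. *)
have self r : maximal_ray bs u r -> r v -> ~ r (a v).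
  move=> m rv rav; have [B [C [rB rC [h nu]]]] := anti_rays m m rv rav.
  have [hr _] := m; apply: (ray_extremal hr rB rC _ _ h) => e; apply: nu.
    by left.
  by right.
case: hv hav => hv [] hav.
- by case: (self _ m1 hv hav).
- exact: anti_rays m1 m2 hv hav.
- by apply: (anti_rays m1 m2 hav); rewrite anti_invol.
by case: (self _ m2 hv hav).
Qed.

(** Every maximal ray is connected, so uniqueness within the boundary is uniqueness among all
    maximal rays. *)
Lemma boundary_antipodal_ray_map : is_antipodal_ray_map a.
Proof.
move=> u r m; split=> [|->//].
have hr : boundary s A r by split=> //; exact: maximal_ray_connected m.
pose v : boundary s A := exist _ r (mem_set hr).
by move=> h; have /antiE <- : anti u v by [].
Qed.

End SphericalBoundary.

Theorem theorem5p8 (T : Type) (s : T -> T -> set T)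
    (hs : is_regular_pasch s \/ exists a : T -> T, is_spherical_pasch s a)
    (A : T) :
  exists a : boundary s A -> boundary s A,
    is_antipodal_ray_map a /\ is_spherical_pasch (@boundary_between T s A) a.
Proof.
(* The construction rests on four facts, established separately for regular and spherical spaces. *)
suff [hl hp hV hline] : [/\ is_line_space s, pasch_condition s,
    unjoined_opposite s & line_closed s].
  have [a ha] := choice (fun u : boundary s A => anti_exists hl u).
  by exists a; split;
    [exact: boundary_antipodal_ray_map|exact: boundary_spherical].
case: hs => [[[hsp hp] hc]|[a ha]].
  have hl : is_line_space s by split=> // B C _; exact: hc.
  split=> //; last exact: regular_line_closed.
  by move=> B P Q _ _ PQ []; split.
have [hsp hp] := spherical_pasch ha.
have hb := swmr_betweenness hsp.
have hl : is_line_space s.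
  (* If [C] is the antipode of [B], then [s B C] has only the two points [B] and [C], so [X] cannot
     be interior. *)
  split=> // B C [X [hX nX]]; apply: (spherical_connected ha) => e; apply: nX.
  have BC : B <> C by move=> e'; apply: (spherical_nofix ha (B := B));
    rewrite -e.
  have hB : s B C B by exact: between_self.
  have hC : s B C C by apply/(between_sym hb)/(between_self hb).
  have [Y [Z [_ e']]] := spherical_pair ha (spherical_invol ha B).
  rewrite -e in e'; rewrite e' in hX hB hC.
  by case: hB hC hX => [] eB [] eC [] eX;
    [left|left|left|right|right|left|left|left]; congruence.
split=> //; [exact: spherical_unjoined ha|exact: spherical_line_closed ha].
Qed.
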